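(* Let $K$ be a field and let $\Sigma$ be a rational pointed fan in $\mathbb{R}^d$. Then the toric face ring $K[\Sigma]$ is clean if and only if the following conditions are satisfied: (i) $\Sigma$ is (non-pure) shellable with a shelling $C_1,\dots,C_s$; (ii) (for this shelling) for every $1<j\le s$ there exists $\gamma_j\in C_j\cap\mathbb{Z}^d$ such that (a) $\operatorname{star}_{\operatorname{Fan}(C_j)}(\gamma_j)=\operatorname{Fan}(C_j)\setminus\bigcup_{i=1}^{j-1}\operatorname{Fan}(C_i)$, and (b) $\bigcup_{D\in\operatorname{star}_{\operatorname{Fan}(C_j)}(\gamma_j)}\big(\operatorname{relint}(D)\cap\mathbb{Z}^d\big)=\gamma_j+(C_j\cap\mathbb{Z}^d)$. In particular, whether $K[\Sigma]$ is clean does not depend on the characteristic of $K$.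
   Context: A rational pointed fan $\Sigma$ in $\mathbb{R}^d$ is a non-empty finite collection of rational pointed (i.e. containing no line) polyhedral cones in $\mathbb{R}^d$ such that every face of a cone in $\Sigma$ is in $\Sigma$ and the intersection of any two cones of $\Sigma$ is a common face of both; in particular $\{0\}\in\Sigma$. Put $|\Sigma|=\bigcup_{C\in\Sigma}C$ and $\dim\Sigma=\max_{C\in\Sigma}\dim C$. The facets of $\Sigma$ are its inclusion-maximal cones. The toric face ring of $\Sigma$ over $K$ is the $\mathbb{Z}^d$-graded $K$-algebra with $K$-basis $\{x^a : a\in |\Sigma|\cap\mathbb{Z}^d\}$ and multiplication $x^a x^b=x^{a+b}$ if $a,b$ lie in a common cone of $\Sigma$, and $x^ax^b=0$ otherwise. For a cone $C$, $\operatorname{Fan}(C)$ is the fan of all faces of $C$ (including $C$), and $\operatorname{Fan}(\partial C)$ is the fan of all proper faces of $C$. For $a\in\mathbb{Z}^d$ and a fan $\Pi$, $\operatorname{star}_\Pi(a)=\{D\in\Pi: a\in D\}$. $\operatorname{relint}$ denotes relative interior. A shelling of $\Sigma$ (not required to be pure) is a linear ordering $C_1,\dots,C_s$ of the facets of $\Sigma$ such that either $\dim\Sigma=0$, or (recursively): (1) $\operatorname{Fan}(\partial C_1)$ has a shelling; and (2) for every $1<j\le s$ there is a shelling $D_1,\dots,D_{t_j}$ of $\operatorname{Fan}(\partial C_j)$ such that $\emptyset\ne\bigcup_{i=1}^{j-1}\big(\operatorname{Fan}(C_i)\cap\operatorname{Fan}(C_j)\big)=\bigcup_{l=1}^{r_j}\operatorname{Fan}(D_l)$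 for some $1\le r_j\le t_j$. $\Sigma$ is shellable if it has a shelling. Let $R$ be a Noetherian ring and $M$ a finitely generated $R$-module. A prime filtration of $M$ is a finite filtration $0=M_0\subset M_1\subset\dots\subset M_r=M$ by submodules with $M_i/M_{i-1}\cong R/P_i$ for prime ideals $P_i$ of $R$, $1\le i\le r$. It is clean if $\{P_1,\dots,P_r\}=\operatorname{Min}(\operatorname{Supp}M)$ (the set of minimal elements of the support of $M$). $M$ is clean if it admits a clean filtration. The ring $K[\Sigma]$ is clean if it is clean as a module over itself. *)

(* Defs.v *)
From HB Require Import structures.
From mathcomp Require Import all_boot all_order all_algebra finmap.
From mathcomp Require Import all_classical reals topology normedtype.
From mathcomp.multinomials Require monalg.
(* The notations of monalg clash with those of mathcomp-analysis. *)
Import -(notations) mathcomp.multinomials.monalg.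

Set Implicit Arguments.
Unset Strict Implicit.
Unset Printing Implicit Defensive.

Import Order.TTheory GRing.Theory Num.Theory.
Import numFieldNormedType.Exports.

Local Open Scope classical_set_scope.
Local Open Scope ring_scope.

Section Cones.
Variables (R : realType) (d : nat).
Local Notation cone := (set 'rV[R]_d).
Implicit Types (C D F S : cone) (Sigma Pi : set cone).

Definition latt (a : 'rV[int]_d) : 'rV[R]_d := map_mx intr a.

Definition lattice_points S : set 'rV[int]_d := latt @^-1` S.

Definition rational_cone C :=
  exists (n : nat) (V : 'M[int]_(n, d)),
    C = [set x | exists c : 'rV[R]_n,
                   (forall i, 0 <= c 0 i) /\ x = c *m map_mx intr V].

(* No line x + R v lies in C. *)
Definition pointed C :=
  forall x v : 'rV[R]_d, (forall t : R, C (x + t *: v)) -> v = 0.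

(* Faces are cut out by supporting linear hyperplanes; u = 0 yields C. *)
Definition face F C :=
  exists u : 'cV[R]_d, (forall x, C x -> 0 <= (x *m u) 0 0) /\
                       F = C `&` [set x | (x *m u) 0 0 = 0].

(* The dimension of the linear span of C. *)
Definition cone_dim C : nat :=
  (\max_(k < d.+1 | `[< exists A : 'M[R]_(k, d),
                          row_free A /\ forall i, C (row i A) >]) k)%N.

Definition affine_hull S : set 'rV[R]_d :=
  [set x | exists n (p : 'M[R]_(n, d)) (l : 'rV[R]_n),
     [/\ forall i, S (row i p), \sum_i l 0 i = 1 & x = l *m p]].

Definition relint S : set 'rV[R]_d :=
  [set x | S x /\ within (affine_hull S) (nbhs x) S].

Record fan := Fan {
  fan_cones :> set cone;
  fan_nonempty : fan_cones !=set0;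
  fan_finite : finite_set fan_cones;
  fan_rational : forall C, fan_cones C -> rational_cone C;
  fan_pointed : forall C, fan_cones C -> pointed C;
  fan_face : forall C F, fan_cones C -> face F C -> fan_cones F;
  fan_inter : forall C D, fan_cones C -> fan_cones D ->
    face (C `&` D) C /\ face (C `&` D) D }.

(* The next notions are stated for arbitrary collections of cones because
   Fan(\partial {0}) is empty, hence not a fan. *)

Definition fan_support Sigma : set 'rV[R]_d := \bigcup_(C in Sigma) C.

Definition fan_dim Sigma : nat := \big[maxn/0%N]_(C \in Sigma) cone_dim C.

Definition facets Sigma : set cone :=
  [set C | Sigma C /\ forall D, Sigma D -> C `<=` D -> D = C].

Definition fan_of C : set cone := [set F | face F C].

Definition bd_fan_of C : set cone := [set F | face F C /\ F <> C].

Definition star Pi (a : 'rV[int]_d) : set cone := [set D | Pi D /\ D (latt a)].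

Definition facet_ordering Sigma (s : seq cone) :=
  uniq s /\ [set C | C \in s] = facets Sigma.

(* The ordering is C_0, ..., C_(size s - 1), with indices starting at 0. *)
Inductive shelling Sigma (s : seq cone) : Prop :=
| shelling_dim0 of facet_ordering Sigma s & fan_dim Sigma = 0%N
| shelling_rec of
    facet_ordering Sigma s
  & (exists Ds, shelling (bd_fan_of (nth set0 s 0)) Ds)
  & (forall j, (0 < j < size s)%N ->
      exists (Ds : seq cone) (r : nat),
      let common := \bigcup_(i in `I_j)
            (fan_of (nth set0 s i) `&` fan_of (nth set0 s j)) in
      [/\ shelling (bd_fan_of (nth set0 s j)) Ds,
          (1 <= r <= size Ds)%N,
          common !=set0
        & common = \bigcup_(l in `I_r) fan_of (nth set0 Ds l)]).

End Cones.

Section MonomialProduct.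
Variables (R : realType) (d : nat) (Sigma : fan R d).
Implicit Types C D : set 'rV[R]_d.

Definition monom_idx :=
  {a : 'rV[int]_d | a \in lattice_points (fan_support Sigma)}.

Definition common_cone (a b : monom_idx) :=
  exists C, [/\ fan_cones Sigma C, C (latt R (val a)) & C (latt R (val b))].

(* The exponent of x^a x^b, None standing for x^a x^b = 0; insub never fails
   here, see monom_mulE. *)
Definition monom_mul (a b : monom_idx) : option monom_idx :=
  if `[< common_cone a b >] then insub (val a + val b) else None.

Lemma lattD (a b : 'rV[int]_d) : latt R (a + b) = latt R a + latt R b.
Proof. exact: raddfD. Qed.

Lemma latt0 : latt R (0 : 'rV[int]_d) = 0.
Proof. exact: raddf0. Qed.

Lemma rational_coneD C x y : rational_cone C -> C x -> C y -> C (x + y).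
Proof.
move=> [n [V ->]] [c [c0 ->]] [e [e0 ->]]; exists (c + e).
by split; [move=> i; rewrite mxE addr_ge0 | rewrite mulmxDl].
Qed.

Lemma rational_cone0 C : rational_cone C -> C 0.
Proof.
by move=> [n [V ->]]; exists 0; split=> [i|]; rewrite ?mxE // mul0mx.
Qed.

Lemma fan_coneD C x y : fan_cones Sigma C -> C x -> C y -> C (x + y).
Proof. by move=> /fan_rational; exact: rational_coneD. Qed.

Lemma fan_cone_summand C D x y :
  fan_cones Sigma C -> fan_cones Sigma D -> C x -> C y -> D (x + y) -> D x.
Proof.
move=> SC SD Cx Cy Dxy.
have [[u [u0 uE]] _] := fan_inter SC SD.
have : (C `&` D) (x + y) by split=> //; exact: fan_coneD.
rewrite uE => -[_] /=; rewrite mulmxDl mxE => /eqP.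
rewrite paddr_eq0 ?u0 // => /andP[/eqP ux _].
by have [] : (C `&` D) x by rewrite uE.
Qed.

Lemma monom_idxP C (a : 'rV[int]_d) :
  fan_cones Sigma C -> C (latt R a) -> a \in lattice_points (fan_support Sigma).
Proof. by move=> SC Ca; rewrite inE; exists C. Qed.

Lemma monom_idx0P : 0 \in lattice_points (fan_support Sigma).
Proof.
have [C SC] := fan_nonempty Sigma; apply: (monom_idxP SC).
by rewrite latt0; apply: rational_cone0; exact: fan_rational SC.
Qed.

Definition monom_idx0 : monom_idx := Sub 0 monom_idx0P.

Lemma monom_mulE a b : common_cone a b ->
  exists2 c, monom_mul a b = Some c & val c = val a + val b.
Proof.
move=> ab; rewrite /monom_mul asboolT //; move: (ab) => [C [SC Ca Cb]].
have abP : val a + val b \in lattice_points (fan_support Sigma).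
  by apply: (monom_idxP SC); rewrite lattD; exact: fan_coneD.
by exists (Sub (val a + val b) abP); rewrite ?SubK // insubT.
Qed.

Lemma monom_mulN a b : ~ common_cone a b -> monom_mul a b = None.
Proof. by move=> ab; rewrite /monom_mul asboolF. Qed.

Lemma monom_mulC : commutative monom_mul.
Proof.
move=> a b; rewrite /monom_mul addrC; congr (if _ then _ else _).
by apply: asbool_equiv_eq; split=> -[C []]; exists C.
Qed.

Lemma monom_mul0 a : monom_mul monom_idx0 a = Some a.
Proof.
have /set_mem[C SC Ca] := valP a.
have /monom_mulE[c -> cE] : common_cone monom_idx0 a.
  exists C; split=> //; rewrite latt0.
  by apply: rational_cone0; exact: fan_rational SC.
by congr Some; apply: val_inj; rewrite cE add0r.
Qed.

Definition common_cone3 (a b c : monom_idx) :=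
  exists C, [/\ fan_cones Sigma C, C (latt R (val a)), C (latt R (val b))
              & C (latt R (val c))].

Lemma monom_mul3 a b c :
  (common_cone3 a b c -> exists2 e,
     obind (monom_mul a) (monom_mul b c) = Some e &
     val e = val a + val b + val c) /\
  (~ common_cone3 a b c -> obind (monom_mul a) (monom_mul b c) = None).
Proof.
split=> [[C [SC Ca Cb Cc]]|abc].
  have /monom_mulE[e -> /= eE] : common_cone b c by exists C.
  have /monom_mulE[f -> fE] : common_cone a e.
    by exists C; split=> //; rewrite [val e]eE lattD; exact: fan_coneD.
  by exists f => //; rewrite fE [val e]eE addrA.
have [bc|/monom_mulN -> //] := pselect (common_cone b c).
have [e -> /= eE] := monom_mulE bc.
apply: monom_mulN => -[D [SD Da]]; rewrite [val e]eE lattD => De; apply: abc.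
case: bc => C [SC Cb Cc]; exists D; split=> //.
  exact: fan_cone_summand SC SD Cb Cc De.
by rewrite addrC in De; exact: fan_cone_summand SC SD Cc Cb De.
Qed.

Lemma monom_mulA a b c :
  obind (monom_mul a) (monom_mul b c) = obind (monom_mul^~ c) (monom_mul a b).
Proof.
have -> : obind (monom_mul^~ c) (monom_mul a b) =
          obind (monom_mul c) (monom_mul a b).
  by case: (monom_mul a b) => //= e; rewrite monom_mulC.
have [P1 P2] := monom_mul3 a b c; have [Q1 Q2] := monom_mul3 c a b.
have [abc|abc] := pselect (common_cone3 a b c).
  have [e -> eE] := P1 abc; have [|f -> fE] := Q1 _.
    by case: abc => C []; exists C.
  by congr Some; apply: val_inj; rewrite eE fE -[RHS]addrA [RHS]addrC.
rewrite P2 // Q2 // => -[C []] SC Cc Ca Cb; apply: abc; by exists C.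
Qed.

End MonomialProduct.

Lemma bilinear_assoc (K : nzRingType) (V : lmodType K) (T : Type) (X : T -> V)
    (mul : V -> V -> V)
    (ext : forall P : V -> Prop, P 0 ->
      (forall f g, P f -> P g -> P (f + g)) ->
      (forall c f, P f -> P (c *: f)) -> (forall a, P (X a)) -> forall f, P f)
    (mulDl : left_distributive mul +%R) (mulDr : right_distributive mul +%R)
    (mulZl : forall c f g, mul (c *: f) g = c *: mul f g)
    (mulZr : forall c f g, mul f (c *: g) = c *: mul f g) :
  (forall a b c, mul (X a) (mul (X b) (X c)) = mul (mul (X a) (X b)) (X c)) ->
  associative mul.
Proof.
move=> XA f g h.
have mul0l k : mul 0 k = 0 by rewrite -[X in mul X](scale0r 0) mulZl scale0r.
have mul0r k : mul k 0 = 0 by rewrite -[X in mul _ X](scale0r 0) mulZr scale0r.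
elim/ext: f => [|f1 f2 E1 E2|e f1 E1|a]; first by rewrite !mul0l.
- by rewrite !mulDl E1 E2.
- by rewrite !mulZl E1.
elim/ext: g => [|g1 g2 E1 E2|e g1 E1|b]; first by rewrite mul0l mul0r mul0l.
- by rewrite mulDl !mulDr mulDl E1 E2.
- by rewrite mulZl !mulZr mulZl E1.
elim/ext: h => [|h1 h2 E1 E2|e h1 E1|c]; first by rewrite !mul0r.
- by rewrite !mulDr E1 E2.
- by rewrite !mulZr E1.
exact: XA.
Qed.

(* Finitely supported functions |Sigma| \cap Z^d -> K, with basis the x^a
   (xmonomE) and multiplication given by xmonomM and xmonomM0. *)
Definition toric_face_ring (K : fieldType) (R : realType) (d : nat)
  (Sigma : fan R d) := malg (monom_idx Sigma) K.

HB.instance Definition _ K R d (Sigma : fan R d) :=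
  GRing.Lmodule.on (toric_face_ring K Sigma).

(* x^a *)
HB.lock Definition xmonom (K : fieldType) (R : realType) (d : nat)
  (Sigma : fan R d) (a : monom_idx Sigma) : toric_face_ring K Sigma :=
  mkmalgU a 1.

Definition xmonom_mul (K : fieldType) (R : realType) (d : nat)
    (Sigma : fan R d) (a b : monom_idx Sigma) : toric_face_ring K Sigma :=
  oapp (@xmonom K R d Sigma) 0 (monom_mul a b).

(* The bilinear extension of xmonom_mul *)
HB.lock Definition tfr_mul (K : fieldType) (R : realType) (d : nat)
    (Sigma : fan R d) (f g : toric_face_ring K Sigma) :
    toric_face_ring K Sigma :=
  \sum_(a <- msupp f) \sum_(b <- msupp g)
     (mcoeff a f * mcoeff b g) *: xmonom_mul K a b.

Section ToricFaceRing.
Variables (K : fieldType) (R : realType) (d : nat) (Sigma : fan R d).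
Local Notation A := (toric_face_ring K Sigma).
Local Notation xmonom := (@xmonom K R d Sigma).
Local Notation xmonom_mul := (@xmonom_mul K R d Sigma).
Local Notation tfr_mul := (@tfr_mul K R d Sigma).
Implicit Types (f g h : A) (a b : monom_idx Sigma).

Definition tfr_one : A := xmonom (monom_idx0 Sigma).

Let tfr_mulw (D E : {fset monom_idx Sigma}) f g :
  (msupp f `<=` D)%fset -> (msupp g `<=` E)%fset ->
  tfr_mul f g = \sum_(a <- D) \sum_(b <- E)
     (mcoeff a f * mcoeff b g) *: xmonom_mul a b.
Proof.
move=> fD gE; rewrite tfr_mul.unlock (big_fset_incl _ fD) /=; last first.
  move=> a _ /mcoeff_outdom fa0.
  by rewrite big1 // => b _; rewrite fa0 mul0r scale0r.
apply: eq_bigr => a _; apply: big_fset_incl => // b _ /mcoeff_outdom ->.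
by rewrite mulr0 scale0r.
Qed.

Let tfr_mulDl : left_distributive tfr_mul +%R.
Proof.
move=> f g h; set D := (msupp f `|` msupp g)%fset.
rewrite (@tfr_mulw D (msupp h) (f + g)) ?msuppD_le //.
rewrite (@tfr_mulw D (msupp h) f) ?fsubsetUl //.
rewrite (@tfr_mulw D (msupp h) g) ?fsubsetUr //.
rewrite -big_split; apply: eq_bigr => a _ /=.
rewrite -big_split; apply: eq_bigr => b _ /=.
by rewrite mcoeffD mulrDl scalerDl.
Qed.

Let tfr_mulC : commutative tfr_mul.
Proof.
move=> f g; rewrite tfr_mul.unlock exchange_big; apply: eq_bigr => b _ /=.
by apply: eq_bigr => a _; rewrite mulrC /xmonom_mul monom_mulC.
Qed.

Let tfr_mulDr : right_distributive tfr_mul +%R.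
Proof. by move=> f g h; rewrite tfr_mulC tfr_mulDl !(tfr_mulC f). Qed.

Let tfr_mulZl c f g : tfr_mul (c *: f) g = c *: tfr_mul f g.
Proof.
rewrite (@tfr_mulw (msupp f) (msupp g)) ?msuppZ_le // tfr_mul.unlock scaler_sumr.
apply: eq_bigr => a _; rewrite scaler_sumr; apply: eq_bigr => b _.
by rewrite mcoeffZ scalerA mulrA.
Qed.

Let tfr_mulZr c f g : tfr_mul f (c *: g) = c *: tfr_mul f g.
Proof. by rewrite tfr_mulC tfr_mulZl tfr_mulC. Qed.

Let tfr_mul0l f : tfr_mul 0 f = 0.
Proof. by rewrite -[X in tfr_mul X](scale0r 0) tfr_mulZl scale0r. Qed.

Let tfr_mul0r f : tfr_mul f 0 = 0.
Proof. by rewrite tfr_mulC tfr_mul0l. Qed.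

Lemma xmonomE f : f = \sum_(a <- msupp f) mcoeff a f *: xmonom a.
Proof.
rewrite [LHS]monalgE; apply: eq_bigr => a _.
by apply/malgP => b; rewrite [RHS]mcoeffZ [LHS]mcoeffU xmonom.unlock mcoeffU mulrnAr mulr1.
Qed.

Let tfr_mulXX a b : tfr_mul (xmonom a) (xmonom b) = xmonom_mul a b.
Proof.
have Xle e : (msupp (xmonom e) `<=` [fset e])%fset.
  by rewrite xmonom.unlock msuppU_le.
have X1 e : mcoeff e (xmonom e) = 1 by rewrite xmonom.unlock mcoeffUU.
by rewrite (tfr_mulw (Xle a) (Xle b)) !big_seq_fset1 !X1 mulr1 scale1r.
Qed.

Let tfr_ext (P : A -> Prop) : P 0 -> (forall f g, P f -> P g -> P (f + g)) ->
  (forall c f, P f -> P (c *: f)) -> (forall a, P (xmonom a)) -> forall f, P f.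
Proof.
move=> P0 PD PZ PX f; rewrite [f]xmonomE.
by elim/big_ind: _ => // a _; exact: PZ.
Qed.

Let tfr_mul1 : left_id tfr_one tfr_mul.
Proof.
move=> f; elim/tfr_ext: f => [|f g fE gE|c f fE|a].
- exact: tfr_mul0r.
- by rewrite tfr_mulDr fE gE.
- by rewrite tfr_mulZr fE.
by rewrite tfr_mulXX /xmonom_mul monom_mul0.
Qed.

Let tfr_mulA : associative tfr_mul.
Proof.
apply: (bilinear_assoc tfr_ext tfr_mulDl tfr_mulDr tfr_mulZl tfr_mulZr).
move=> a b c.
apply: etrans (congr1 (tfr_mul (xmonom a)) (tfr_mulXX b c)) _.
apply: etrans _ (esym (congr1 (tfr_mul^~ (xmonom c)) (tfr_mulXX a b))).
transitivity (oapp xmonom 0 (obind (monom_mul a) (monom_mul b c))).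
  rewrite /xmonom_mul; case: (monom_mul b c) => [bc|].
    exact: tfr_mulXX.
  exact: tfr_mul0r.
rewrite monom_mulA /xmonom_mul; case: (monom_mul a b) => [ab|].
  by symmetry; exact: tfr_mulXX.
by symmetry; exact: tfr_mul0l.
Qed.

Let tfr_one_neq0 : tfr_one != 0.
Proof. by rewrite /tfr_one xmonom.unlock monalgU_eq0 oner_eq0. Qed.

HB.instance Definition _ := GRing.Zmodule_isComNzRing.Build A
  tfr_mulA tfr_mulC tfr_mul1 tfr_mulDl tfr_one_neq0.

Let tfr_scaleAl c (f g : A) : c *: (f * g) = (c *: f) * g.
Proof. by rewrite -[RHS]/(tfr_mul _ _) tfr_mulZl. Qed.

HB.instance Definition _ := GRing.Lmodule_isLalgebra.Build K A tfr_scaleAl.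
HB.instance Definition _ := GRing.Lalgebra_isComAlgebra.Build K A.

Lemma xmonomME a b : xmonom a * xmonom b = oapp xmonom 0 (monom_mul a b).
Proof. exact: tfr_mulXX. Qed.

Lemma xmonomM a b : common_cone a b ->
  exists2 c, val c = val a + val b & xmonom a * xmonom b = xmonom c.
Proof.
move=> /monom_mulE[c abc cE]; exists c; first exact: cE.
by apply: etrans (xmonomME a b) _; rewrite abc.
Qed.

Lemma xmonomM0 a b : ~ common_cone a b -> xmonom a * xmonom b = 0.
Proof.
by move=> /monom_mulN ab; apply: etrans (xmonomME a b) _; rewrite ab.
Qed.

End ToricFaceRing.

Section QuotientModule.
Variables (A : nzRingType) (M : lmodType A) (L : submodClosed M).
Local Open Scope quotient_scope.

Fact submod_zmodP : zmod_closed L.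
Proof. exact/GRing.submod_closedB/submodClosedP. Qed.

Definition submod_zmod : zmodClosed M :=
  HB.pack (GRing.SubmodClosed.sort L)
    (GRing.isZmodClosed.Build M (GRing.SubmodClosed.sort L) submod_zmodP).

Definition quot_mod := Quotient.quot submod_zmod.

HB.instance Definition _ := GRing.Zmodule.on quot_mod.

Definition quot_pi (x : M) : quot_mod := \pi_(Quotient.quot submod_zmod) x.

Definition quot_scale (a : A) (x : quot_mod) : quot_mod := quot_pi (a *: repr x).

Lemma quot_piE x y : (quot_pi x == quot_pi y) = (x - y \in L).
Proof. by rewrite -Quotient.idealrBE. Qed.

Lemma quot_pi_surj (u : quot_mod) : {x | u = quot_pi x}.
Proof. by exists (repr u); rewrite /quot_pi reprK. Qed.

Lemma quot_piD : {morph quot_pi : x y / x + y}.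
Proof. by move=> x y; rewrite /quot_pi raddfD. Qed.

Lemma quot_scaleE a x : quot_scale a (quot_pi x) = quot_pi (a *: x).
Proof.
apply/eqP; rewrite quot_piE -scalerBr rpredZ // -quot_piE.
by rewrite /quot_pi reprK.
Qed.

Let quot_scaleA a b u : quot_scale a (quot_scale b u) = quot_scale (a * b) u.
Proof. by have [x ->] := quot_pi_surj u; rewrite !quot_scaleE scalerA. Qed.

Let quot_scale1 : left_id 1 quot_scale.
Proof.
by move=> u; have [x ->] := quot_pi_surj u; rewrite quot_scaleE scale1r.
Qed.

Let quot_scaleDr : right_distributive quot_scale +%R.
Proof.
move=> a u v; have [x ->] := quot_pi_surj u; have [y ->] := quot_pi_surj v.
by rewrite -quot_piD !quot_scaleE scalerDr quot_piD.
Qed.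

Let quot_scaleDl u : {morph quot_scale^~ u : a b / a + b}.
Proof.
move=> a b; have [x ->] := quot_pi_surj u.
by rewrite !quot_scaleE scalerDl quot_piD.
Qed.

HB.instance Definition _ := GRing.Zmodule_isLmodule.Build A quot_mod
  quot_scaleA quot_scale1 quot_scaleDr quot_scaleDl.

Let quot_pi_additive : {morph quot_pi : x y / x - y}.
Proof. by move=> x y; rewrite /quot_pi raddfB. Qed.

HB.instance Definition _ :=
  GRing.isZmodMorphism.Build M quot_mod quot_pi quot_pi_additive.

Let quot_pi_scalable : scalable quot_pi.
Proof. by move=> a x; exact/esym/quot_scaleE. Qed.

HB.instance Definition _ :=
  GRing.isScalable.Build A M quot_mod *:%R quot_pi quot_pi_scalable.

End QuotientModule.

Section CleanModule.
Variable A : comNzRingType.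

Section PrimeIdeal.
Variable P : prime_idealr A.

Fact prime_submodP : submod_closed (P : {pred A^o}).
Proof.
split=> [|a x y xP yP]; first exact: idealr0.
by rewrite rpredD // idealMr.
Qed.

Definition prime_submod : submodClosed A^o :=
  HB.pack ((P : A -> bool) : A^o -> bool)
    (GRing.isSubmodClosed.Build A A^o (P : A -> bool) prime_submodP).

End PrimeIdeal.

Variable M : lmodType A.
Implicit Types (L N : submodClosed M) (P Q : {pred A}) (m : M) (s t : A).

(* Equality of the fractions m/s and n/t in the localization of M at the
   prime P. *)
Definition loc_eq P (x y : M * A) :=
  exists2 u, u \notin P & u *: (y.2 *: x.1 - x.2 *: y.1) = 0.

Definition prime_ideal P := idealr_closed P /\ prime_idealr_closed P.

(* The primes P such that the localization of M at P is nonzero. *)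
Definition module_supp : set {pred A} :=
  [set P | prime_ideal P /\ exists m s, s \notin P /\ ~ loc_eq P (m, s) (0, 1)].

Definition min_supp : set {pred A} :=
  [set P | module_supp P /\ forall Q, module_supp Q -> {subset Q <= P} -> Q = P].

(* The quotient N / L, viewed inside M / L, is isomorphic to A / P. *)
Definition subquot_iso L N (P : prime_idealr A) :=
  exists f : {linear quot_mod (prime_submod P) -> quot_mod L},
    injective f /\ range f = [set quot_pi L m | m in [set m | m \in N]].

Definition prime_filtration (r : nat) (F : nat -> submodClosed M)
    (P : 'I_r -> prime_idealr A) :=
  [/\ F 0%N =i pred1 0,
      F r =i predT
    & forall i : 'I_r, {subset F i <= F i.+1} /\ subquot_iso (F i) (F i.+1) (P i)].

Definition clean :=
  exists r (F : nat -> submodClosed M) (P : 'I_r -> prime_idealr A),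
    prime_filtration F P /\ range (fun i => P i : {pred A}) = min_supp.

End CleanModule.

Definition clean_ring (A : comNzRingType) := clean A^o.

(* Main.v *)
(* Both sides are equivalent to a condition on the lattice points alone, called
   monoid_shelling below: the facets of Sigma can be ordered C_1, ..., C_s in
   such a way that, for all j, the lattice points of C_j lying in no earlier
   facet form a set gamma_j + (C_j \cap Z^d).

   The minimal primes of K[Sigma] are the ideals P_C of the elements without
   monomial in the facet C, and their intersection is 0.  In a clean filtration
   (F_k) with factors A/P_k, each minimal prime occurs once and F_k is forced to
   be the intersection of the P_l, l >= k; hence the filtration is monomial, and
   its factors are cyclic iff certain monomial ideals of the domains K[C] are
   principal.  The generator of such an ideal is a monomial, since the extremal
   terms of a product with respect to a generic linear form do not cancel.

   Conversely, the faces of C_j in the earlier facets are those that do not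
   contain gamma_j, and Bruggesser-Mani line shellings give a shelling of the
   boundary of C_j starting with the facets visible from any given point of the
   span of C_j, here -gamma_j, that is, with those avoiding gamma_j. *)

Require Import Defs.
From HB Require Import structures.
From mathcomp Require Import all_boot all_order all_algebra finmap.
From mathcomp Require Import all_classical reals topology normedtype.
From mathcomp.multinomials Require monalg.
Import -(notations) mathcomp.multinomials.monalg.
From mathcomp Require Import lra zify.

Set Implicit Arguments.
Unset Strict Implicit.
Unset Printing Implicit Defensive.

Import Order.TTheory GRing.Theory Num.Theory.
Import numFieldNormedType.Exports.
Local Open Scope classical_set_scope.
Local Open Scope ring_scope.

(** * Finitely generated cones and Fourier-Motzkin elimination *)

Section PolyhedralCones.
Variables (R : realType) (d : nat).
Local Notation vec := 'rV[R]_d.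
Local Notation form := 'cV[R]_d.
Implicit Types (C D F G : set 'rV[R]_d) (u w : 'cV[R]_d) (x y v : 'rV[R]_d).
Implicit Types (s : seq 'rV[R]_d).

Definition ev x u : R := (x *m u) 0 0.

Lemma evDl x y u : ev (x + y) u = ev x u + ev y u.
Proof. by rewrite /ev mulmxDl mxE. Qed.
Lemma evNl x u : ev (- x) u = - ev x u.
Proof. by rewrite /ev mulNmx mxE. Qed.
Lemma evBl x y u : ev (x - y) u = ev x u - ev y u.
Proof. by rewrite evDl evNl. Qed.
Lemma evZl t x u : ev (t *: x) u = t * ev x u.
Proof. by rewrite /ev -scalemxAl mxE. Qed.
Lemma ev0l u : ev 0 u = 0.
Proof. by rewrite /ev mul0mx mxE. Qed.
Lemma evDr x u w : ev x (u + w) = ev x u + ev x w.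
Proof. by rewrite /ev mulmxDr mxE. Qed.
Lemma evNr x u : ev x (- u) = - ev x u.
Proof. by rewrite /ev mulmxN mxE. Qed.
Lemma evBr x u w : ev x (u - w) = ev x u - ev x w.
Proof. by rewrite evDr evNr. Qed.
Lemma evZr t x u : ev x (t *: u) = t * ev x u.
Proof. by rewrite /ev -scalemxAr mxE. Qed.
Lemma ev0r x : ev x 0 = 0.
Proof. by rewrite /ev mulmx0 mxE. Qed.
Definition evE := (evDl, evNl, evZl, ev0l, evDr, evNr, evZr, ev0r).

Lemma ev_suml (I : Type) (r : seq I) (f : I -> vec) u :
  ev (\sum_(i <- r) f i) u = \sum_(i <- r) ev (f i) u.
Proof.
by elim: r => [|i r IH]; rewrite ?big_nil ?ev0l // !big_cons evDl IH.
Qed.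

Lemma ev_sumr (I : Type) (r : seq I) (f : I -> form) x :
  ev x (\sum_(i <- r) f i) = \sum_(i <- r) ev x (f i).
Proof.
by elim: r => [|i r IH]; rewrite ?big_nil ?ev0r // !big_cons evDr IH.
Qed.

(** Recursion on the generators allows eliminating one coefficient at a time: the ray from [x] in
    direction [- v] has to meet the cone over [s']. *)
Fixpoint cone s : set vec :=
  if s is v :: s' then [set x | exists2 t, 0 <= t & cone s' (x - t *: v)]
  else [set 0].

Definition nonneg_on C u := forall x, C x -> 0 <= ev x u.

Lemma cone0 s : cone s 0.
Proof. by elim: s => [//|v s IH]; exists 0 => //; rewrite scale0r subr0. Qed.

Lemma coneD s x y : cone s x -> cone s y -> cone s (x + y).
Proof.
elim: s x y => [|v s IH] x y /=; first by move=> -> ->; rewrite addr0.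
move=> [a a0 ax] [b b0 bx]; exists (a + b); first exact: addr_ge0.
by rewrite scalerDl opprD addrACA; exact: IH.
Qed.

Lemma coneZ s t x : 0 <= t -> cone s x -> cone s (t *: x).
Proof.
move=> t0; elim: s x => [|v s IH] x /=; first by move=> ->; rewrite scaler0.
move=> [a a0 ax]; exists (t * a); first exact: mulr_ge0.
by rewrite -scalerA -scalerBr; exact: IH.
Qed.

Lemma cone_gen s v : v \in s -> cone s v.
Proof.
elim: s => [//|w s IH]; rewrite inE => /orP[/eqP ->|vs] /=.
  by exists 1; rewrite ?ler01 // scale1r subrr; exact: cone0.
by exists 0; rewrite ?lexx // scale0r subr0; exact: IH.
Qed.

Lemma cone_sub s C : C 0 -> (forall x y, C x -> C y -> C (x + y)) ->
  (forall t x, 0 <= t -> C x -> C (t *: x)) -> (forall v, v \in s -> C v) ->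
  cone s `<=` C.
Proof.
move=> C0 CD CZ; elim: s => [|v s IH] sC x /=; first by move=> ->.
move=> [t t0 xt]; rewrite -[x](subrK (t *: v)); apply: CD.
  by apply: IH => // w ws; apply: sC; rewrite inE ws orbT.
by apply: CZ => //; apply: sC; rewrite inE eqxx.
Qed.

Lemma nonneg_on_cone s u : (forall v, v \in s -> 0 <= ev v u) ->
  nonneg_on (cone s) u.
Proof.
move=> su; apply: cone_sub => //=; first by rewrite ev0l.
- by move=> x y; rewrite evDl; exact: addr_ge0.
- by move=> t x t0 x0; rewrite evZl mulr_ge0.
Qed.

(** In a nonnegative combination on which [u] vanishes, the generators with positive [u]-value have
    coefficient zero. *)
Lemma cone_filter s u : nonneg_on (cone s) u ->
  cone s `&` [set x | ev x u = 0] = cone [seq v <- s | ev v u == 0].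
Proof.
move=> su; apply/seteqP; split=> [x []|x]; last first.
  move: x; apply: cone_sub => /=.
  - by split; [exact: cone0|rewrite ev0l].
  - move=> x y [xs xu] [ys yu]; split; first exact: coneD.
    by rewrite evDl xu yu addr0.
  - by move=> t x t0 [xs xu]; split; [exact: coneZ|rewrite evZl xu mulr0].
  - by move=> v; rewrite mem_filter => /andP[/eqP vu /cone_gen].
elim: s x su => [//|v s IH] x su [t t0 xt] /= xu.
have su' : nonneg_on (cone s) u.
  by apply: nonneg_on_cone => w ws; apply/su/cone_gen; rewrite inE ws orbT.
have v0 : 0 <= ev v u by apply/su/cone_gen; rewrite inE eqxx.
move: xu; rewrite -{1}[x](subrK (t *: v)) evDl evZl => /eqP.
rewrite paddr_eq0 ?mulr_ge0 ?(su' _ xt) // => /andP[/eqP x0].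
rewrite mulf_eq0 => /orP[/eqP te|ve]; last first.
  by rewrite ve /=; exists t => //; exact: IH.
have {}x0 : ev x u = 0 by move: x0; rewrite te scale0r subr0.
have xs : cone s x by move: xt; rewrite te scale0r subr0.
by case: ifP => _ /=; [exists 0 => //; rewrite scale0r subr0|]; exact: IH.
Qed.

Lemma min_seq (T : eqType) (r : seq T) (f : T -> R) : r != [::] ->
  exists2 m, m \in r & forall k, k \in r -> f m <= f k.
Proof.
elim: r => // a [|b r] IH _.
  by exists a; rewrite ?inE // => k; rewrite inE => /eqP ->.
have [m mr mP] := IH isT; have [am|ma] := leP (f a) (f m).
  exists a; first by rewrite inE eqxx.
  move=> k; rewrite inE => /orP[/eqP -> //|/mP]; exact: le_trans.
exists m; first by rewrite inE mr orbT.
by move=> k; rewrite inE => /orP[/eqP ->|/mP //]; exact: ltW.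
Qed.

(** Each [u] bounds [t]: from above if it is positive on [v], from below if negative. The second
    hypothesis says that no lower bound exceeds an upper bound; the first says that the upper bounds
    are nonnegative and covers the forms vanishing on [v]. *)
Lemma fourier_motzkin (U : seq form) v x :
  (forall u, u \in U -> 0 <= ev v u -> 0 <= ev x u) ->
  (forall u w, u \in U -> w \in U -> 0 < ev v u -> ev v w < 0 ->
     0 <= ev x (ev v u *: w - ev v w *: u)) ->
  exists2 t, 0 <= t & forall u, u \in U -> 0 <= ev (x - t *: v) u.
Proof.
move=> xU xUU; pose f u := ev x u / ev v u.
pose N := [seq u <- U | ev v u < 0].
have [N0|/eqP N0] := pselect (N = [::]).
  pose P := [seq u <- U | 0 < ev v u].
  have tP u : u \in U -> 0 <= ev v u.
    move=> uU; rewrite leNgt; apply/negP => vu.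
    by have : u \in N; [rewrite mem_filter vu|rewrite N0].
  by exists 0 => // u uU; rewrite scale0r subr0; apply: xU => //; exact: tP.
have [w wN wP] := min_seq (fun u => - f u) N0.
have [wv wU] : ev v w < 0 /\ w \in U by move: wN; rewrite mem_filter => /andP[].
(* The largest lower bound: [w] minimises [- f] over the forms negative on [v]. *)
exists (Num.max 0 (f w)); first by rewrite le_max lexx.
move=> u uU; rewrite evBl evZl subr_ge0.
have [vu|vu|vu] := ltgtP (ev v u) 0.
- have : f u <= f w.
    by rewrite -lerN2; apply: wP; rewrite mem_filter vu.
  rewrite {1}/f ler_ndivrMr // => h; apply: le_trans h.
  by rewrite ler_nM2r // le_max lexx orbT.
- rewrite /Num.max; case: ifP => _; last by rewrite mul0r xU // ltW.
  have := xUU _ _ uU wU vu wv; rewrite !evE => h.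
  by rewrite /f mulrAC ler_ndivrMr //; lra.
- by rewrite vu mulr0; apply: xU => //; rewrite vu.
Qed.

Definition hrep C (U : seq form) :=
  forall x, C x <-> forall u, u \in U -> 0 <= ev x u.

(** One half of the Minkowski-Weyl theorem, by induction on the generators; the coordinate forms and
    their negatives cut out the zero cone. *)
Lemma cone_hrep s : exists U, hrep (cone s) U.
Proof.
elim: s => [|v s [U UP]].
  exists ([seq (delta_mx i 0 : form) | i <- enum 'I_d] ++
          [seq (- delta_mx i 0 : form) | i <- enum 'I_d]).
  move=> x; split=> [-> u _|xU]; first by rewrite ev0l.
  apply/rowP => i; rewrite mxE.
  have xi : ev x (delta_mx i 0) = x 0 i.
    rewrite /ev -colE mxE //.
  apply/eqP; rewrite eq_le -xi xU ?mem_cat; last first.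
    by apply/orP; left; apply/mapP; exists i; rewrite ?mem_enum.
  rewrite andbT -oppr_ge0 -evNr xU // mem_cat; apply/orP; right.
  by apply/mapP; exists i; rewrite ?mem_enum.
(* Each pair of forms with opposite signs at [v] contributes its positive combination vanishing at
   [v]. *)
exists ([seq u <- U | 0 <= ev v u] ++
        [seq ev v p.1 *: p.2 - ev v p.2 *: p.1 |
           p <- [seq (u, w) | u <- [seq u <- U | 0 < ev v u],
                              w <- [seq u <- U | ev v u < 0]]]).
move=> x; split=> [[t t0 /UP xt] u|xU].
  rewrite mem_cat => /orP[|].
    rewrite mem_filter => /andP[vu uU].
    by have := xt _ uU; rewrite evBl evZl subr_ge0; apply: le_trans; exact: mulr_ge0.
  move=> /mapP[[u1 u2] /allpairsP[[a b] /= []]].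
  rewrite !mem_filter => /andP[av aU] /andP[bv bU] [-> ->] ->.
  have := xt _ aU; have := xt _ bU; rewrite !evE => h1 h2.
  have h3 := mulr_ge0 (ltW av) h1.
  have h4 := mulr_ge0_le0 h2 (ltW bv).
  nra.
have [|u w uU wU vu vw|t t0 tP] := @fourier_motzkin U v x; last first.
  by exists t => //; apply/UP.
  apply: xU; rewrite mem_cat; apply/orP; right; apply/mapP; exists (u, w) => //.
  by apply/allpairsP; exists (u, w); rewrite !mem_filter vu vw uU wU.
by move=> u uU vu; apply: xU; rewrite mem_cat mem_filter vu uU.
Qed.

End PolyhedralCones.


(** * Faces and inner points of cones *)

Section Faces.
Variables (R : realType) (d : nat).
Local Notation vec := 'rV[R]_d.
Local Notation form := 'cV[R]_d.
Implicit Types (B C D F G H : set 'rV[R]_d) (u w : 'cV[R]_d).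
Implicit Types (x y v q : 'rV[R]_d) (s : seq 'rV[R]_d).

Definition fg_cone C := exists s, C = cone s.

Lemma face_refl C : face C C.
Proof.
exists 0; split=> [x _|]; first by rewrite -/(ev x 0) ev0r.
by apply/seteqP; split=> [x Cx|x []//]; split=> //=; rewrite -/(ev x 0) ev0r.
Qed.

Lemma face_sub F C : face F C -> F `<=` C.
Proof. by move=> [u [_ ->]] x []. Qed.

Lemma face_sub_face H F C : face H C -> H `<=` F -> F `<=` C -> face H F.
Proof.
move=> [u [u0 HE]] HF FC; exists u; split=> [x /FC /u0 //|].
apply/seteqP; split=> [x Hx|x [Fx xu]]; last by rewrite HE; split=> //; exact: FC.
by split; [exact: HF|move: Hx; rewrite HE => -[]].
Qed.

Lemma face_cone F s : face F (cone s) ->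
  exists2 u, nonneg_on (cone s) u & F = cone [seq v <- s | ev v u == 0].
Proof. by move=> [u [u0 ->]]; exists u; rewrite -?cone_filter. Qed.

Lemma fg_face F C : fg_cone C -> face F C -> fg_cone F.
Proof. by move=> [s ->] /face_cone[u _ ->]; eexists. Qed.

(** The form [w] of [H] may be negative on [C] outside [F], but [u] is positive at the generators
    off [F], so adding a large multiple of [u] repairs this. *)
Lemma face_trans H F C : fg_cone C -> face F C -> face H F -> face H C.
Proof.
move=> [s ->] [u [u0 FE]] [w [w0 HE]].
pose N := \sum_(v <- s) `|ev v w / ev v u|.
have NP v : v \in s -> 0 <= ev v (N *: u + w).
  move=> vs; rewrite !evE; have vC := cone_gen vs.
  have [vu|vu] := eqVneq (ev v u) 0.
    by rewrite vu mulr0 add0r; apply: w0; rewrite FE.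
  have {}vu : 0 < ev v u by rewrite lt_neqAle eq_sym vu; exact: u0.
  have : `|ev v w / ev v u| <= N.
    by rewrite /N (big_rem v) //= lerDl sumr_ge0.
  rewrite normrM normfV (gtr0_norm vu) ler_pdivrMr // => h.
  by have := ler_norm (- ev v w); rewrite normrN; lra.
have NC := nonneg_on_cone NP.
(* A sum of two forms nonnegative on [C] vanishes only where both do, so the extra [u] forces the
   zero set into [F]. *)
exists ((N *: u + w) + u); split.
  by move=> x sx; rewrite -/(ev _ _) evDr addr_ge0 //; [exact: NC|exact: u0].
rewrite HE FE; apply/seteqP; split=> [x [[sx xu] xw]|x [sx xw]].
  split=> //=; rewrite -/(ev _ _) !evE.
  by rewrite [ev x u]xu [ev x w]xw mulr0 !addr0.
move: xw => /=; rewrite -/(ev _ _) evDr => /eqP.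
rewrite paddr_eq0; [|exact: NC|exact: u0].
rewrite !evE => /andP[/eqP h /eqP xu]; split; first by split.
by move: h; rewrite xu mulr0 add0r.
Qed.

(* For finitely generated C this is membership in relint C, in a form that makes
   sense without topology: no proper face contains q. *)
Definition inner C q :=
  C q /\ forall u, nonneg_on C u -> ev q u = 0 -> forall x, C x -> ev x u = 0.

(** A nonnegative form that vanishes at the sum of the generators vanishes at each of them. *)
Lemma inner_sum s : inner (cone s) (\sum_(v <- s) v).
Proof.
split=> [|u u0].
  rewrite big_seq; elim/big_ind: _ => [|x y|v].
  - exact: cone0.
  - exact: coneD.
  - exact: cone_gen.
rewrite ev_suml big_seq => /eqP; rewrite psumr_eq0; last first.
  by move=> v /cone_gen /u0.
move=> /allP sP x sx.
have : (cone s `&` [set x | ev x u = 0]) x.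
  rewrite cone_filter //; move: x sx; apply: cone_sub.
  - exact: cone0.
  - exact: coneD.
  - exact: coneZ.
  - move=> v vs; apply: cone_gen; rewrite mem_filter vs andbT.
    by have /implyP := sP v vs; apply.
by case.
Qed.

Lemma inner_exists C : fg_cone C -> exists q, inner C q.
Proof. by move=> [s ->]; eexists; exact: inner_sum. Qed.

(** The form cutting out [F] is nonnegative on [D] and zero at the inner point [q], hence zero on
    [D]. *)
Lemma inner_face_sub F C D q :
  inner D q -> face F C -> D `<=` C -> F q -> D `<=` F.
Proof.
move=> [Dq qP] [u [u0 FE]] DC; rewrite FE => -[Cq qu] x Dx; split.
  exact: DC.
by apply: (qP u) => // y /DC /u0.
Qed.

(** A face is generated by the generators lying on it, so a mask on [s] determines it. *)
Lemma finite_faces C : fg_cone C -> finite_set (fan_of C).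
Proof.
move=> [s ->].
apply: (@sub_finite_set _ _ ((fun m : (size s).-tuple bool => cone (mask m s)) @` setT)).
  move=> F /face_cone[u _ ->].
  exists [tuple of [seq ev v u == 0 | v <- in_tuple s]] => //=.
  by rewrite -filter_mask.
exact: finite_image.
Qed.

Lemma maximal_seq (r : seq (set vec)) C : C \in r ->
  exists D, [/\ D \in r, C `<=` D & forall E, E \in r -> D `<=` E -> E = D].
Proof.
elim: r C => // A r IH C.
have aux B : B \in r -> exists D, [/\ D \in A :: r, B `<=` D &
    forall E, E \in A :: r -> D `<=` E -> E = D].
  move=> /IH[D [Dr BD Dmax]]; have [DA|DA] := pselect (D `<=` A); last first.
    exists D; rewrite inE Dr orbT; split=> // E.
    by rewrite inE => /orP[/eqP -> /DA|/Dmax].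
  exists A; rewrite inE eqxx; split=> //; first exact: subset_trans DA.
  move=> E; rewrite inE => /orP[/eqP //|Er] AE.
  have ED := Dmax E Er (subset_trans DA AE).
  by apply/seteqP; split=> //; rewrite ED.
rewrite inE => /orP[/eqP ->|/aux //].
have [[B [Br AB]]|noB] := pselect (exists B, B \in r /\ A `<=` B).
  have [D [Dr BD Dmax]] := aux B Br; exists D; split=> //.
  exact: subset_trans BD.
exists A; rewrite inE eqxx; split=> // E; rewrite inE => /orP[/eqP //|Er AE].
by case: noB; exists E.
Qed.

Lemma finite_maximal (S : set (set vec)) C : finite_set S -> S C ->
  exists2 D, facets S D & C `<=` D.
Proof.
move=> /finite_seqP[r ->] /maximal_seq[D [Dr CD Dmax]].
by exists D.
Qed.

Lemma proper_face_sub_facet C G : fg_cone C -> bd_fan_of C G ->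
  exists2 F, facets (bd_fan_of C) F & G `<=` F.
Proof.
move=> fgC; apply: finite_maximal; apply: sub_finite_set (finite_faces fgC).
by move=> F [].
Qed.

End Faces.


(** Closeness arguments are run with a large parameter instead of a small one, so that finitely many
    of them combine without topology. *)
Lemma large_seq (R : realType) (T : eqType) (r : seq T) (Q : T -> R -> Prop) :
  (forall k, k \in r -> exists t0, forall t, t0 <= t -> Q k t) ->
  exists t0, forall t, t0 <= t -> forall k, k \in r -> Q k t.
Proof.
elim: r => [|a r IH] rQ; first by exists 0.
have [|t1 t1P] := rQ a; first by rewrite inE eqxx.
have [k kr|t2 t2P] := IH; first by apply: rQ; rewrite inE kr orbT.
exists (Num.max t1 t2) => t; rewrite ge_max => /andP[h1 h2] k.
by rewrite inE => /orP[/eqP ->|]; [exact: t1P|exact: t2P].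
Qed.

Lemma large_affine_ge (R : realType) (a b : R) :
  0 < a -> exists t0, forall t, t0 <= t -> 0 <= t * a + b.
Proof.
move=> a0; exists (- b / a) => t; rewrite ler_pdivrMr //; lra.
Qed.

Lemma large_affine_neq0 (R : realType) (a b : R) :
  (a != 0) || (b != 0) -> exists t0, forall t, t0 <= t -> t * a + b != 0.
Proof.
have [-> /= b0|a0 _] := eqVneq a 0; first by exists 0 => t _; rewrite mulr0 add0r.
exists (- b / a + 1) => t ht; apply/eqP => h.
have : t = - b / a by apply: (mulIf a0); rewrite divfK //; lra.
lra.
Qed.

(** * Facet inequalities within the span of a cone *)

Section Facets.
Variables (R : realType) (d : nat).
Local Notation vec := 'rV[R]_d.
Local Notation form := 'cV[R]_d.
Implicit Types (B C D F G H : set 'rV[R]_d) (u w : 'cV[R]_d).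
Implicit Types (x y v q : 'rV[R]_d) (s : seq 'rV[R]_d).

(** A chosen supporting form; when [F] is not a face of [C] it is the default [0]. *)
Definition facet_form C F : form :=
  xget 0 [set u | nonneg_on C u /\ F = C `&` [set x | ev x u = 0]].

Lemma facet_formP C F : face F C -> nonneg_on C (facet_form C F) /\
  F = C `&` [set x | ev x (facet_form C F) = 0].
Proof. by move=> CF; exact: (xgetPex 0 CF). Qed.

Definition lin C : set vec := [set x | exists a b, [/\ C a, C b & x = a - b]].

Lemma lin_ev0 C x u : lin C x -> (forall y, C y -> ev y u = 0) -> ev x u = 0.
Proof. by move=> [a [b [Ca Cb ->]]] u0; rewrite evBl !u0 // subrr. Qed.

Lemma linD C x y : fg_cone C -> lin C x -> lin C y -> lin C (x + y).
Proof.
move=> [s ->] [a [b [Ca Cb ->]]] [a' [b' [Ca' Cb' ->]]].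
exists (a + a'), (b + b'); split; try exact: coneD.
by rewrite opprD addrACA.
Qed.

Lemma linZ C t x : fg_cone C -> lin C x -> lin C (t *: x).
Proof.
move=> [s ->] [a [b [Ca Cb ->]]]; have [t0|t0] := leP 0 t.
  by exists (t *: a), (t *: b); split; rewrite -?scalerBr //; exact: coneZ.
have nt : 0 <= - t by rewrite oppr_ge0 ltW.
exists (- t *: b), (- t *: a); split; try exact: coneZ.
by rewrite !scaleNr opprK scalerBr addrC.
Qed.

Lemma sub_lin C x : fg_cone C -> C x -> lin C x.
Proof.
by move=> [s ->] Cx; exists x, 0; split; rewrite ?subr0 //; exact: cone0.
Qed.

Lemma inner_facet_form C F q : fg_cone C -> bd_fan_of C F -> inner C q ->
  0 < ev q (facet_form C F).
Proof.
move=> fgC [CF FC] [Cq qP]; have [u0 FE] := facet_formP CF.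
rewrite lt_neqAle u0 // andbT eq_sym; apply/eqP => /(qP _ u0) uC.
apply: FC; rewrite FE; apply/seteqP; split=> [x []//|x Cx]; split=> //.
exact: uC.
Qed.

(* Moving from x towards an inner point of C, one enters C through a facet that
   separates x from C. *)
Lemma facets_cut C x : fg_cone C -> lin C x ->
  (forall F, facets (bd_fan_of C) F -> 0 <= ev x (facet_form C F)) -> C x.
Proof.
move=> fgC Cx xF; apply: contrapT => nCx.
have [q qin] := inner_exists fgC; have [Cq qP] := qin.
have [s CE] := fgC; have [U UP] := cone_hrep s; rewrite -CE in UP.
have U0 u : u \in U -> nonneg_on C u by move=> uU y /UP; apply.
(* Forms of [U] that vanish at [q] vanish on the span of [C]; only the others can exclude [x]. *)
pose L := [seq u <- U | ev q u != 0].
have ev0 u : u \in U -> ev q u = 0 -> ev x u = 0.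
  by move=> uU qu; apply: lin_ev0 Cx _; exact: qP (U0 _ uU) qu.
have qL u : u \in L -> 0 < ev q u /\ u \in U.
  rewrite mem_filter => /andP[qu uU]; split=> //.
  by rewrite lt_neqAle eq_sym qu U0.
have [u [uL xu]] : exists u, u \in L /\ ev x u < 0.
  apply: contrapT => h; apply/nCx/UP => u uU; rewrite leNgt; apply/negP => xu.
  apply: h; exists u; split=> //; rewrite mem_filter uU andbT.
  by apply/eqP => /(ev0 _ uU) xu0; rewrite xu0 ltxx in xu.
have L0 : L != [::] by apply/eqP => L0; rewrite L0 in uL.
(* Going from [x] in direction [q], the inequality of [u] holds from time [- (ev x u / ev q u)] on;
   that of [m] is the last to become valid, at time [tau]. *)
have [m mL mP] := min_seq (fun u => ev x u / ev q u) L0.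
pose tau := - (ev x m / ev q m).
have tau0 : 0 < tau.
  rewrite oppr_gt0; apply: le_lt_trans (mP u uL) _.
  by rewrite ltr_pdivrMr ?mul0r; case: (qL _ uL).
have [qm mU] := qL _ mL.
have Cy : C (x + tau *: q).
  apply/UP => w wU; rewrite evDl evZl; have [qw|qw] := eqVneq (ev q w) 0.
    by rewrite (ev0 w) // qw mulr0 addr0.
  have wL : w \in L by rewrite mem_filter qw.
  have [{}qw _] := qL _ wL.
  by have := mP _ wL; rewrite ler_pdivlMr // /tau mulNr subr_ge0.
have ym : ev (x + tau *: q) m = 0.
  by rewrite evDl evZl /tau mulNr divfK ?subrr // gt_eqF.
pose G := C `&` [set y | ev y m = 0].
have CG : bd_fan_of C G.
  split; first by exists m; split=> //; exact: U0.
  by move=> GC; have : G q; [rewrite GC|case=> _ /eqP; rewrite gt_eqF].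
have [F fF GF] := proper_face_sub_facet fgC CG.
have : F (x + tau *: q) by apply: GF.
have [CF _] := fF; have [u0 ->] := facet_formP CF.1.
move=> [_ /=]; rewrite evDl evZl => h.
have := xF _ fF; have := mulr_gt0 tau0 (inner_facet_form fgC CF qin); lra.
Qed.

Lemma facets_seq C : fg_cone C -> exists2 Fs : seq (set vec), uniq Fs &
  [set F | F \in Fs] = facets (bd_fan_of C).
Proof.
move=> fgC; have : finite_set (facets (bd_fan_of C)).
  by apply: sub_finite_set (finite_faces fgC) => F [[]].
move=> /finite_seqP[r rE]; exists (undup r); first exact: undup_uniq.
by rewrite rE; apply/seteqP; split=> F /=; rewrite mem_undup.
Qed.

(* t g + x stands for the point g + x / t, which is close to g. *)
Lemma push_into_cone C G g x : fg_cone C -> G `<=` C -> inner G g -> lin C x ->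
  (forall F, facets (bd_fan_of C) F -> G `<=` F -> 0 <= ev x (facet_form C F)) ->
  exists t, C (t *: g + x).
Proof.
move=> fgC GC gin Cx xF; have [Fs _ FsE] := facets_seq fgC.
have [|t tP] := @large_seq R _ Fs (fun F t => 0 <= ev (t *: g + x) (facet_form C F)).
  move=> F FFs; have fF : facets (bd_fan_of C) F by rewrite -FsE.
  have [CF _] := fF; have [u0 FE] := facet_formP CF.1.
  have gu : 0 <= ev g (facet_form C F) by apply/u0/GC; case: gin.
  have [gu0|gu0] := eqVneq (ev g (facet_form C F)) 0.
    exists 0 => t _; rewrite evDl evZl gu0 mulr0 add0r; apply: xF => //.
    apply: (inner_face_sub gin CF.1 GC); rewrite FE; split=> //.
    by apply: GC; case: gin.
  have [|t0 t0P] := @large_affine_ge R (ev g (facet_form C F)) (ev x (facet_form C F)).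
    by rewrite lt_neqAle eq_sym gu0.
  by exists t0 => t /t0P; rewrite evDl evZl.
exists t; apply: facets_cut => //.
  by apply: linD => //; apply: linZ => //; apply/sub_lin/GC => //; case: gin.
by move=> F; rewrite -FsE; exact: tP.
Qed.

(** An inner point of [F] lies on no other facet, so [x] can be pushed along it into [C]; the result
    is on the hyperplane of [F], hence in [F]. *)
Lemma lin_facet C F x : fg_cone C -> facets (bd_fan_of C) F -> lin C x ->
  ev x (facet_form C F) = 0 -> lin F x.
Proof.
move=> fgC fF Cx xF; have [[CF FC] Fmax] := fF.
have fgF := fg_face fgC CF; have [f fin] := inner_exists fgF.
have [u0 FE] := facet_formP CF.
have [F' fF' FF'|t Ct] := push_into_cone fgC (face_sub CF) fin Cx.
  by rewrite (Fmax F') ?xF //; case: fF'.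
have Ff : F f by case: fin.
have Ft : F (t *: f + x).
  have fF0 : ev f (facet_form C F) = 0 by move: Ff; rewrite {1}FE => -[].
  by rewrite FE; split=> //=; rewrite evDl evZl xF fF0 mulr0 addr0.
rewrite -[x](addKr (t *: f)) addrC -scaleNr.
by apply: linD => //; [exact: sub_lin|apply/linZ/sub_lin].
Qed.

End Facets.


(** * Line shellings of the boundary of a cone *)

Section Shelling.
Variables (R : realType) (d : nat).
Local Notation vec := 'rV[R]_d.
Local Notation form := 'cV[R]_d.
Implicit Types (B C D F G H : set 'rV[R]_d) (u w : 'cV[R]_d).
Implicit Types (x y v q : 'rV[R]_d) (s : seq 'rV[R]_d).

(** Hyperplanes are avoided one at a time: for large [t], [t *: w + v] stays off those that [w]
    avoids and off the new one that [v] avoids. *)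
Lemma generic_in_cone s (L : seq form) :
  (forall u, u \in L -> exists2 v, cone s v & ev v u != 0) ->
  exists2 v, cone s v & forall u, u \in L -> ev v u != 0.
Proof.
elim: L => [|a L IH] LP; first by exists 0 => //; exact: cone0.
have [u uL|w ws wP] := IH; first by apply: LP; rewrite inE uL orbT.
have [|v vs va] := LP a; first by rewrite inE eqxx.
have [|t0 t0P] := @large_seq R _ (a :: L) (fun u t => ev (t *: w + v) u != 0).
  move=> u; rewrite inE => uL.
  have [|t0 t0P] := @large_affine_neq0 R (ev w u) (ev v u).
    by case/orP: uL => [/eqP ->|/wP ->]; rewrite ?va ?orbT.
  by exists t0 => t /t0P; rewrite evDl evZl.
exists (Num.max 0 t0 *: w + v).
  by apply: coneD => //; apply: coneZ => //; rewrite le_max lexx.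
by apply: t0P; rewrite le_max lexx orbT.
Qed.

(** A facet has fewer generators; this drives the induction in [bruggesser_mani]. *)
Lemma facet_form_cone s F : facets (bd_fan_of (cone s)) F ->
  F = cone [seq v <- s | ev v (facet_form (cone s) F) == 0] /\
  (size [seq v <- s | ev v (facet_form (cone s) F) == 0%R] < size s)%N.
Proof.
move=> [[CF FC] _]; have [u0 FE] := facet_formP CF.
rewrite [LHS]FE -cone_filter //; split=> //.
rewrite size_filter ltnNge; apply/negP => h; apply: FC.
rewrite FE cone_filter //; congr cone; apply/all_filterP.
by rewrite all_count eqn_leq count_size.
Qed.

(** If the two forms, normalised to the value 1 at [q], agreed on the cone, they would have the same
    zero set there. Denominators are cleared. *)
Lemma facet_form_neq s F G q : inner (cone s) q ->
  facets (bd_fan_of (cone s)) F -> facets (bd_fan_of (cone s)) G -> F <> G ->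
  exists2 v, cone s v & ev v (ev q (facet_form (cone s) G) *: facet_form (cone s) F -
                              ev q (facet_form (cone s) F) *: facet_form (cone s) G) != 0.
Proof.
move=> qin fF fG; have fgC : fg_cone (cone s) by exists s.
apply: contra_notP => h.
have qF := inner_facet_form fgC fF.1 qin; have qG := inner_facet_form fgC fG.1 qin.
have {}h v : cone s v ->
    ev q (facet_form (cone s) G) * ev v (facet_form (cone s) F) =
    ev q (facet_form (cone s) F) * ev v (facet_form (cone s) G).
  move=> vs; apply/eqP; rewrite -subr_eq0; apply/negP => /negP h'.
  by apply: h; exists v; rewrite // evBr !evZr.
have [_ FE] := facet_formP fF.1.1; have [_ GE] := facet_formP fG.1.1.
rewrite FE GE; apply/seteqP; split=> v [sv /= v0]; split=> //=; have := h v sv.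
  by rewrite v0 mulr0 => /esym/eqP; rewrite mulf_eq0 gt_eqF //= => /eqP.
by rewrite v0 mulr0 => /eqP; rewrite mulf_eq0 gt_eqF //= => /eqP.
Qed.

(* The line shelling will use the points p - a q: the last clause says that
   this line meets the spans of distinct facets in distinct points. *)
Lemma line_exists C x q : fg_cone C -> inner C q -> lin C x ->
  exists p, [/\ lin C p,
    forall F, facets (bd_fan_of C) F ->
      (ev p (facet_form C F) < 0) = (ev x (facet_form C F) < 0)
  & forall F G, facets (bd_fan_of C) F -> facets (bd_fan_of C) G ->
      ev p (facet_form C F) / ev q (facet_form C F) =
      ev p (facet_form C G) / ev q (facet_form C G) -> F = G].
Proof.
move=> fgC qin Cx; have [Fs _ FsE] := facets_seq fgC.
have FsP F : F \in Fs <-> facets (bd_fan_of C) F by rewrite -FsE.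
have [s CE] := fgC; rewrite CE in fgC qin Cx FsE FsP *.
set f := facet_form (cone s).
(* For facets [F] and [G], [phi (F, G)] vanishes at [p] exactly when the line through [p] in
   direction [q] meets both hyperplanes at the same parameter. *)
pose phi (P : set vec * set vec) := ev q (f P.2) *: f P.1 - ev q (f P.1) *: f P.2.
pose L := [seq P <- [seq (F, G) | F <- Fs, G <- Fs] | P.1 != P.2].
have LP P : P \in L <-> [/\ facets (bd_fan_of (cone s)) P.1,
                           facets (bd_fan_of (cone s)) P.2 & P.1 <> P.2].
  rewrite mem_filter; split=> [/andP[/eqP neq /allpairsP[Q /= [/FsP h1 /FsP h2]]]|].
    by move=> PE; move: neq; rewrite PE.
  move=> [/FsP h1 /FsP h2 neq]; apply/andP; split; first exact/eqP.
  by apply/allpairsP; exists P; split=> //; case: (P).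
have [|w ws wP] := @generic_in_cone s (map phi L).
  by move=> u /mapP[P /LP[h1 h2 neq] ->]; exact: facet_form_neq.
have [|t1 t1P] := @large_seq R _ L (fun P t => ev (t *: x + w) (phi P) != 0).
  move=> P PL; have [|t0 t0P] := @large_affine_neq0 R (ev x (phi P)) (ev w (phi P)).
    by rewrite (wP (phi P)) ?orbT //; exact: map_f.
  by exists t0 => t /t0P; rewrite evDl evZl.
have [|t2 t2P] := @large_seq R _ Fs (fun F t => ev x (f F) < 0 -> ev (t *: x + w) (f F) < 0).
  move=> F _; have [xF|xF] := ltP (ev x (f F)) 0; last by exists 0.
  have [|t0 t0P] := @large_affine_ge R (- ev x (f F)) (- ev w (f F) - 1).
    by rewrite oppr_gt0.
  by exists t0 => t /t0P; rewrite evDl evZl; lra.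
(* For such [t] negative values at [x] stay negative; nonnegative ones stay so because [w] lies in
   the cone and [t] is nonnegative. *)
pose t := Num.max 0 (Num.max t1 t2).
have t0 : 0 <= t by rewrite le_max lexx.
exists (t *: x + w); split.
- by apply: linD => //; [exact: linZ|exact: sub_lin].
- move=> F fF; apply/idP/idP => [|xF]; last first.
    by apply: t2P => //; rewrite ?le_max ?lexx ?orbT //; exact/FsP.
  rewrite evDl evZl; apply: contraTT; rewrite -!leNgt => xF.
  rewrite addr_ge0 ?mulr_ge0 //; have [u0 _] := facet_formP fF.1.1.
  exact: u0.
move=> F G fF fG eFG; apply: contrapT => neq.
have FGL : (F, G) \in L by apply/LP.
have qF := inner_facet_form fgC fF.1 qin; have qG := inner_facet_form fgC fG.1 qin.
have : ev (t *: x + w) (phi (F, G)) != 0.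
  by apply: t1P => //; rewrite !le_max lexx !orbT.
case/negP; rewrite evBr !evZr /= subr_eq0 mulrC [eqbRHS]mulrC.
by rewrite -eqr_div ?(lt0r_neq0 qF) ?(lt0r_neq0 qG) //; apply/eqP.
Qed.

Lemma bigcup_take_fan (Ds : seq (set vec)) r H : (r <= size Ds)%N ->
  (\bigcup_(l in `I_r) fan_of (nth set0 Ds l)) H <->
  exists2 G, G \in take r Ds & face H G.
Proof.
move=> rs; split=> [[l /= lr Hl]|[G /(nthP set0)[l]]].
  exists (nth set0 Ds l) => //; rewrite -(nth_take _ lr) mem_nth //.
  by rewrite size_takel.
by rewrite size_takel // => lr; rewrite nth_take // => <- HG; exists l.
Qed.

Lemma sorted_prefix (T : eqType) (l : seq T) (f : T -> R) :
  sorted (fun a b => f a <= f b) l ->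
  exists2 r, (r <= size l)%N &
    forall a, a \in take r l <-> a \in l /\ f a < 0.
Proof.
elim: l => [|a l IH] /=; first by exists 0%N => // b; split => [|[]].
move=> aF; have [r rs rP] := IH (path_sorted aF).
have [a0|a0] := ltP (f a) 0.
  exists r.+1 => // b; rewrite /= !inE; split.
    by case/orP => [/eqP ->|/rP[-> ->]]; rewrite ?eqxx ?orbT.
  by case=> /orP[-> //|h1 h2]; apply/orP; right; apply/rP.
exists 0%N => // b; split=> // -[]; rewrite inE => /orP[/eqP ->|bl].
  by rewrite ltNge a0.
have tr : transitive (fun a b => f a <= f b).
  by move=> ? ? ? /le_trans; apply.
move: aF; rewrite (path_sortedE tr) => /andP[/allP/(_ _ bl) h _].
by rewrite ltNge (le_trans a0 h).
Qed.

(** The facets are ordered by the parameter [al F] at which the line [p - t q] crosses the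
    hyperplane of [F]. Those visible from [x] have negative parameter, so they come first.
    Boundaries of facets are handled by induction on the number of generators. *)
Lemma bruggesser_mani n s x : (size s < n)%N -> lin (cone s) x ->
  exists Ds r, [/\ shelling (bd_fan_of (cone s)) Ds, (r <= size Ds)%N &
    forall F, F \in take r Ds <->
      facets (bd_fan_of (cone s)) F /\ ev x (facet_form (cone s) F) < 0].
Proof.
elim: n s x => // n IH s x sn Cx; set C := cone s.
have fgC : fg_cone C by exists s.
have [q qin] := inner_exists fgC.
have [p [Cp pE pinj]] := line_exists fgC qin Cx.
pose f F := facet_form C F; pose al F := ev p (f F) / ev q (f F).
have [Fs uFs FsE] := facets_seq fgC.
pose Ds := sort (fun F G => al F <= al G) Fs.
have DsP F : F \in Ds <-> facets (bd_fan_of C) F by rewrite mem_sort -FsE.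
have srt : sorted (fun F G => al F <= al G) Ds.
  by apply: sort_sorted => F G; exact: le_total.
have ord : facet_ordering (bd_fan_of C) Ds.
  by split; rewrite ?sort_uniq // -FsE; apply/seteqP; split=> F /=; rewrite mem_sort.
have qf F : facets (bd_fan_of C) F -> 0 < ev q (f F).
  by move=> fF; exact: inner_facet_form fgC fF.1 qin.
have [r rs rP] := sorted_prefix srt.
exists Ds, r; split=> //; last first.
  move=> F; apply: (iff_trans (rP F)); apply: (iff_trans (and_iff_compat_r _ (DsP F))).
  split=> -[fF h]; split=> //; move: h; rewrite /al -pE // ?ltr_pdivrMr ?mul0r //; exact: qf.
(* Without facets the boundary fan is empty, and its dimension, an empty maximum, is 0. *)
have [Ds0|Ds0] := eqVneq Ds [::].
  apply: shelling_dim0 => //.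
  suff -> : bd_fan_of C = set0 by rewrite /fan_dim fsbig_set0.
  rewrite -subset0 => G /(proper_face_sub_facet fgC)[F /DsP].
  by rewrite Ds0.
have size_Ds : (0 < size Ds)%N by rewrite lt0n size_eq0.
have facetD j : (j < size Ds)%N -> facets (bd_fan_of C) (nth set0 Ds j).
  by move=> js; apply/DsP; exact: mem_nth.
have IHD j y : (j < size Ds)%N -> lin (nth set0 Ds j) y ->
    exists Es r', [/\ shelling (bd_fan_of (nth set0 Ds j)) Es, (r' <= size Es)%N &
    forall F, F \in take r' Es <-> facets (bd_fan_of (nth set0 Ds j)) F /\
       ev y (facet_form (nth set0 Ds j) F) < 0].
  move=> js; have [FE Fs'] := facet_form_cone (facetD j js).
  by rewrite {1}FE => /(IH _ _ (leq_trans Fs' sn)); rewrite -FE.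
apply: shelling_rec => //.
  have [|Es [r' [? _ _]]] := IHD 0%N 0 size_Ds; last by exists Es.
  apply: sub_lin; first exact: fg_face fgC (facetD _ size_Ds).1.1.
  by have [FE _] := facet_form_cone (facetD 0%N size_Ds); rewrite FE; exact: cone0.
move=> j /andP[j0 js]; set Fj := nth set0 Ds j.
have fFj : facets (bd_fan_of C) Fj by exact: facetD.
have CFj := fFj.1.1; have fgFj := fg_face fgC CFj.
have al_lt i k : (i < k < size Ds)%N -> al (nth set0 Ds i) < al (nth set0 Ds k).
  move=> /andP[ik ks]; have is_ := ltn_trans ik ks.
  rewrite lt_neqAle; apply/andP; split.
    apply/eqP => /(pinj _ _ (facetD _ is_) (facetD _ ks))/eqP.
    by rewrite nth_uniq ?sort_uniq // ltn_eqF.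
  have tr : transitive (fun F G => al F <= al G).
    by move=> ? ? ? /le_trans; apply.
  have rf : reflexive (fun F G => al F <= al G) by move=> ?; exact: lexx.
  by apply: (sorted_leq_nth tr rf _ srt) => //; exact: ltnW.
(* The point where the line meets the span of Fj; the facets of Fj visible
   from y are those lying in an earlier facet of C. *)
pose y := p - al Fj *: q.
have Cy : lin C y.
  by rewrite /y -scaleNr; apply: linD => //; apply/linZ/sub_lin => //; case: qin.
have yE F : facets (bd_fan_of C) F -> ev y (f F) = (al F - al Fj) * ev q (f F).
  by move=> fF; rewrite evBl evZl mulrBl divfK // gt_eqF ?qf.
have Fjy : lin Fj y.
  have yj : ev y (f Fj) = 0 by rewrite yE // subrr mul0r.
  exact: (lin_facet fgC fFj Cy yj).
have [Es [r' [shE r's r'P]]] := IHD j y js Fjy.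
have EsP G := bigcup_take_fan G r's.
(* The first facet in the ordering is visible from [y], so [y] is outside [C]; hence some facet of
   [Fj] is visible from [y] and [r'] is positive. *)
have nFjy : ~ Fj y.
  move=> /(face_sub CFj) {}Cy; have fF0 := facetD 0%N size_Ds.
  have [u0 _] := facet_formP fF0.1.1.
  have := u0 _ Cy; rewrite leNgt => /negP; apply.
  by rewrite yE // pmulr_llt0 ?qf // subr_lt0 al_lt // j0.
have r'0 : (0 < r')%N.
  rewrite lt0n; apply/eqP => r0; apply/nFjy/(facets_cut fgFj Fjy) => G fG.
  by rewrite leNgt; apply/negP => yG; have /r'P := conj fG yG; rewrite r0 take0.
exists Es, r'; rewrite -/Fj.
set common := bigcup _ _ => /=.
suff commonE : common = \bigcup_(l in `I_r') fan_of (nth set0 Es l).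
  split=> //; first by rewrite r'0.
  by rewrite commonE; exists (nth set0 Es 0); exists 0%N => //; exact: face_refl.
apply/seteqP; split=> H.
  move=> [i /= ij [Hi Hj]].
  have fFi := facetD i (ltn_trans ij js).
  (* If no visible facet of [Fj] contained [H], then [y] could be pushed along an inner point of [H]
     into [Fj]; but the form of the earlier facet through [H] is zero at that point and negative at
     [y]. *)
  apply/EsP; apply: contrapT => noG.
  have fgH := fg_face fgFj Hj; have [h hin] := inner_exists fgH.
  have [G fG HG|t Ct] := push_into_cone fgFj (face_sub Hj) hin Fjy.
    rewrite leNgt; apply/negP => yG; apply: noG; exists G; first exact/r'P.
    by apply: face_sub_face Hj HG (face_sub fG.1.1).
  have [u0 FiE] := facet_formP fFi.1.1.
  have := u0 _ (face_sub CFj Ct); rewrite leNgt => /negP; apply.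
  have : nth set0 Ds i h by apply: (face_sub Hi); case: hin.
  rewrite {1}FiE => -[_ /= h0]; rewrite evDl evZl h0 mulr0 add0r yE //.
  by rewrite pmulr_llt0 ?qf // subr_lt0 al_lt // ij.
move=> /EsP[G /r'P[fG yG] HG].
have FjG := fG.1.1; have CG := face_trans fgC CFj FjG.
have fgG := fg_face fgC CG; have [g gin] := inner_exists fgG.
(* Otherwise all facets of [C] through [G] have parameter at least [al Fj], and [y] can be pushed
   along an inner point of [G] into [C], hence into [Fj], against [yG]. *)
have [i [ij Gi]] : exists i, (i < j)%N /\ G `<=` nth set0 Ds i.
  apply: contrapT => noi.
  have [F fF GF|t Ct] := push_into_cone fgC (face_sub CG) gin Cy.
    rewrite yE // pmulr_lge0 ?qf // subr_ge0 leNgt; apply/negP => alF.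
    have /DsP/(nthP set0)[i is_ iE] := fF.
    apply: noi; exists i; rewrite iE; split=> //.
    rewrite ltnNge; apply/negP; rewrite leq_eqVlt => /orP[/eqP ji|ji].
      by move: alF; rewrite -iE -ji ltxx.
    by move: alF; rewrite -iE ltNge ltW // al_lt // ji.
  have [u0 FjE] := facet_formP CFj; have [w0 GE] := facet_formP FjG.
  have Fjt : Fj (t *: g + y).
    rewrite FjE; split=> //=; rewrite evDl evZl (yE Fj) // subrr mul0r addr0.
    have : Fj g by apply: (face_sub FjG); case: gin.
    by rewrite {1}FjE => -[_ /= ->]; rewrite mulr0.
  have : G g by case: gin.
  rewrite {1}GE => -[_ /= g0]; have := w0 _ Fjt.
  by rewrite evDl evZl g0 mulr0 add0r leNgt yG.
have HFj := face_trans fgFj FjG HG.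
exists i => //; split=> //.
apply: face_sub_face (face_trans fgC CFj HFj) _ _.
  exact: subset_trans (face_sub HG) Gi.
by apply: face_sub; case: (facetD i (ltn_trans ij js)) => -[].
Qed.

End Shelling.


(** * Inner points and the relative interior *)

Section RelativeInterior.
Variables (R : realType) (d : nat).
Local Notation vec := 'rV[R]_d.
Local Notation form := 'cV[R]_d.
Implicit Types (B C D F G H : set 'rV[R]_d) (u w : 'cV[R]_d).
Implicit Types (a x y v q : 'rV[R]_d) (s : seq 'rV[R]_d).

Lemma ev_continuous u : continuous (fun x => ev x u).
Proof.
have sum_cont (r : seq 'I_d) : continuous (fun x : vec => \sum_(i <- r) x 0 i * u i 0).
  elim: r => [|i r IH] x.
    rewrite (_ : (fun x => _) = cst 0); first by apply: cst_continuous.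
    by apply/funext => y; rewrite big_nil.
  rewrite (_ : (fun x => _) = (fun y : vec => y 0 i * u i 0) \+
      (fun y : vec => \sum_(i <- r) y 0 i * u i 0)).
    apply: continuousD; last exact: IH.
    apply: continuousM; last exact: cst_continuous.
    exact: (@coord_continuous R 1 d 0 i x).
  by apply/funext => y; rewrite big_cons.
rewrite (_ : (fun x => _) = (fun x : vec => \sum_i x 0 i * u i 0)) //.
by apply/funext => y; rewrite /ev mxE.
Qed.

Lemma near_seq (T : eqType) (V : Type) (F : set_system V) (FF : Filter F)
    (r : seq T) (Q : T -> V -> Prop) :
  (forall k, k \in r -> \forall y \near F, Q k y) ->
  \forall y \near F, forall k, k \in r -> Q k y.
Proof.
elim: r => [|b r IH] rQ; first by apply: nearW => y k; rewrite in_nil.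
have h1 : \forall y \near F, Q b y by apply: rQ; rewrite inE eqxx.
have h2 : \forall y \near F, forall k, k \in r -> Q k y.
  by apply: IH => k kr; apply: rQ; rewrite inE kr orbT.
near=> y => k; rewrite inE => /orP[/eqP ->|]; first by near: y.
by move: k; near: y.
Unshelve. all: by end_near. Qed.

(** Inequalities strict at [a] stay valid near [a]; those tight at [a] vanish on [C], hence on its
    affine hull. *)
Lemma inner_relint C a : fg_cone C -> inner C a -> relint C a.
Proof.
move=> [s CE] [Ca aP]; split=> //; have [U UP] := cone_hrep s.
have h : \forall y \near a, forall u, u \in U -> affine_hull C y -> 0 <= ev y u.
  apply: (near_seq (nbhs_filter a)) => u uU.
  have u0 : nonneg_on C u by move=> x; rewrite CE => /UP; apply.
  have [au|au] := eqVneq (ev a u) 0.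
    apply: (@nearW _ _ _ (nbhs_filter a)) => y [n [p [l [pC _ ->]]]].
    rewrite mulmx_sum_row ev_suml sumr_ge0 // => i _.
    by rewrite evZl (aP u u0 au) ?mulr0.
  have : \forall y \near a, 0 < ev y u.
    apply: (@ev_continuous u a [set r | 0 < r]).
    by apply: lt_nbhsr; rewrite lt_neqAle eq_sym au u0.
  by apply: (@filterS _ _ (nbhs_filter a)) => y /ltW.
rewrite /within /=; apply: (@filterS _ _ (nbhs_filter a)) h => y yU Cy.
rewrite CE; apply/UP => u uU.
exact: yU.
Qed.

(** The segment from [x] to [a] can be prolonged a little beyond [a] inside [C]; there [u] takes the
    value [- t * ev x u], so [ev x u] cannot be positive. *)
Lemma relint_inner C a : relint C a -> inner C a.
Proof.
move=> [Ca nCa]; split=> // u u0 au x Cx.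
have cvg_a : (fun t : R => a + t *: (a - x)) @ 0^'+ --> a.
  rewrite -[X in _ --> X]addr0; apply: cvgD; first exact: cvg_cst.
  rewrite -[X in _ --> X](scale0r (a - x)); apply: cvgZ; last exact: cvg_cst.
  exact: cvg_at_right_filter cvg_id.
have : \forall t \near 0^'+, C (a + t *: (a - x)).
  have : \forall t \near 0^'+, affine_hull C (a + t *: (a - x)) -> C (a + t *: (a - x)).
    exact: cvg_a nCa.
  apply: filterS => t; apply.
  exists 2%N, (\matrix_(i < 2) if i == 0 then a else x),
    (\row_(i < 2) if i == 0 then 1 + t else - t).
  split.
  - by move=> i; rewrite rowK; case: ifP.
  - by rewrite big_ord_recl big_ord1 !mxE /= addrK.
  - rewrite mulmx_sum_row big_ord_recl big_ord1 !rowK !mxE /=.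
    by rewrite scalerDl scale1r scaleNr scalerBr addrA.
move=> h; near (0:R)^'+ => t.
have t0 : 0 < t by [].
have : 0 <= ev (a + t *: (a - x)) u by apply: u0; near: t.
rewrite !evE au add0r add0r mulrN oppr_ge0 pmulr_rle0 // => xu.
by apply/eqP; rewrite eq_le xu u0.
Unshelve. all: by end_near. Qed.

(** The sum [w] of the inequalities tight at [a] cuts out the face, since it vanishes on the cone
    only where all of them do. *)
Lemma minimal_face C a : fg_cone C -> C a -> exists2 D, face D C & inner D a.
Proof.
move=> [s ->] Ca; have [U UP] := cone_hrep s.
have U0 u : u \in U -> nonneg_on (cone s) u by move=> uU x /UP; apply.
pose L := [seq u <- U | ev a u == 0]; pose w := \sum_(u <- L) u.
have L0 u : u \in L -> nonneg_on (cone s) u.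
  by rewrite mem_filter => /andP[_]; exact: U0.
have w0 : nonneg_on (cone s) w.
  by move=> x sx; rewrite ev_sumr big_seq sumr_ge0 // => u /L0; exact.
have wP x : cone s x -> ev x w = 0 -> forall u, u \in L -> ev x u = 0.
  move=> sx /eqP; rewrite ev_sumr big_seq psumr_eq0; last by move=> u /L0; exact.
  by move=> /allP h u uL; have /implyP/(_ uL)/eqP := h u uL.
have wa : ev a w = 0.
  by rewrite ev_sumr big_seq big1 // => u; rewrite mem_filter => /andP[/eqP].
exists (cone s `&` [set x | ev x w = 0]); first by exists w.
split; first by split.
move=> v v0 av y [sy yw].
(* For large [t] the point [t *: a - y] is still in the face: the forms tight at [a] vanish at [y],
   and the others grow with [t]. *)
have [|t tP] := @large_seq R _ U (fun u t => 0 <= ev (t *: a - y) u).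
  move=> u uU; have [au|au] := eqVneq (ev a u) 0.
    exists 0 => t _; rewrite evBl evZl au mulr0 sub0r (wP y) ?oppr0 //.
    by rewrite mem_filter au eqxx.
  have [|t0 t0P] := @large_affine_ge R (ev a u) (- ev y u).
    by rewrite lt_neqAle eq_sym au U0.
  by exists t0 => t /t0P; rewrite evBl evZl.
have : 0 <= ev (t *: a - y) v.
  apply: v0; split; first exact/UP/tP.
  by rewrite /= evBl evZl wa yw mulr0 subrr.
rewrite evBl evZl av mulr0 sub0r oppr_ge0 => yv; apply/eqP.
by rewrite eq_le yv v0.
Qed.

End RelativeInterior.

(** * Lattice points of rational fans; shellings and monoid shellings *)

Section RationalFans.
Variables (R : realType) (d : nat) (Sigma : fan R d).
Implicit Types (C D F G H : set 'rV[R]_d).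

Lemma rational_fg C : rational_cone C ->
  exists s : seq 'rV[int]_d, C = cone (map (@latt R d) s).
Proof.
move=> rC; have [n [V CE]] := rC.
have CZ t x : 0 <= t -> C x -> C (t *: x).
  move=> t0; rewrite CE => -[c [c0 ->]]; exists (t *: c).
  by split=> [i|]; rewrite ?scalemxAl // mxE mulr_ge0.
exists [seq row i V | i <- enum 'I_n]; apply/seteqP; split=> [x|].
  rewrite {1}CE => -[c [c0 ->]]; rewrite mulmx_sum_row.
  elim/big_ind: _ => [|x1 x2|i _]; [exact: cone0|exact: coneD|].
  apply: coneZ => //; apply: cone_gen; apply/mapP; exists (row i V).
    by apply: map_f; rewrite mem_enum.
  by rewrite /latt map_row.
apply: cone_sub => //.
- exact: rational_cone0.
- by move=> x y; exact: rational_coneD.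
move=> v /mapP[b /mapP[i _ ->] ->]; rewrite CE; exists (delta_mx 0 i).
split=> [j|]; first by rewrite mxE ler0n.
by rewrite -rowE /latt map_row.
Qed.

Lemma fan_fg C : fan_cones Sigma C -> fg_cone C.
Proof. by move=> /fan_rational /rational_fg[s ->]; eexists. Qed.

Lemma inner_lattice C : fan_cones Sigma C -> exists a, inner C (latt R a).
Proof.
move=> /fan_rational /rational_fg[s ->]; exists (\sum_(v <- s) v).
by rewrite /latt raddf_sum -(big_map (@latt R d) xpredT id); exact: inner_sum.
Qed.

Lemma inner_fan_sub C D a : fan_cones Sigma C -> fan_cones Sigma D ->
  inner C a -> D a -> C `<=` D.
Proof.
move=> SC SD aC Da; have [CDC _] := fan_inter SC SD.
have : C `<=` C `&` D.
  by apply: (inner_face_sub aC CDC) => //; split=> //; case: aC.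
by move=> h x /h[].
Qed.

Lemma fan_sub_face C D : fan_cones Sigma C -> fan_cones Sigma D ->
  C `<=` D -> face C D.
Proof. by move=> SC SD CD; have [] := fan_inter SC SD; rewrite setIidl. Qed.

Lemma latt_fan_addl C D a b : fan_cones Sigma C -> fan_cones Sigma D ->
  C (latt R a) -> C (latt R b) -> D (latt R (a + b)) -> D (latt R a).
Proof. by move=> SC SD Ca Cb; rewrite lattD; exact: fan_cone_summand SC SD Ca Cb. Qed.

Lemma sub_facet C : fan_cones Sigma C -> exists2 D, facets (fan_cones Sigma) D & C `<=` D.
Proof. exact: finite_maximal (fan_finite Sigma). Qed.

Definition new_points (Cs : seq (set 'rV[R]_d)) (j : nat) : set 'rV[int]_d :=
  [set a | lattice_points (nth set0 Cs j) a /\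
           forall i, (i < j)%N -> ~ lattice_points (nth set0 Cs i) a].

Definition monoid_shelling (Cs : seq (set 'rV[R]_d)) :=
  facet_ordering (fan_cones Sigma) Cs /\
  forall j, (j < size Cs)%N -> exists2 gamma,
    lattice_points (nth set0 Cs j) gamma &
    new_points Cs j = [set gamma + a | a in lattice_points (nth set0 Cs j)].

Section Ordering.
Variable Cs : seq (set 'rV[R]_d).
Hypothesis Cs_ord : facet_ordering (fan_cones Sigma) Cs.

Lemma facet_ordering_nth j : (j < size Cs)%N -> facets (fan_cones Sigma) (nth set0 Cs j).
Proof. by move=> js; have [_ <-] := Cs_ord; exact: mem_nth. Qed.

(** Each lattice point of [Cj] is in the relative interior of some face, and it is new exactly when
    that face belongs to no earlier facet. *)
Lemma new_pointsE (j : nat) (gamma : 'rV[int]_d) : (j < size Cs)%N ->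
  let Cj := nth set0 Cs j in
  star (fan_of Cj) gamma =
    fan_of Cj `\` \bigcup_(i in `I_j) fan_of (nth set0 Cs i) ->
  new_points Cs j = \bigcup_(D in star (fan_of Cj) gamma) lattice_points (relint D).
Proof.
move=> js Cj starE; have SCj := (facet_ordering_nth js).1.
have fgCj := fan_fg SCj.
apply/seteqP; split=> [a [Cja aN]|a [D]].
  have [D CjD Da] := minimal_face fgCj Cja.
  exists D; last by apply: inner_relint Da; exact: fg_face CjD.
  rewrite starE; split=> // -[i /= ij Ci]; apply: (aN i) => //.
  by apply: face_sub Ci _ _; case: Da.
rewrite starE => -[CjD nD] /relint_inner Da; have SD := fan_face SCj CjD.
split; first by apply: (face_sub CjD); case: Da.
move=> i ij Cia; have SCi := (facet_ordering_nth (ltn_trans ij js)).1.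
apply: nD; exists i => //; apply: fan_sub_face => //.
exact: inner_fan_sub Da Cia.
Qed.

(** [gamma] itself is new, so no face containing it is in an earlier facet. Conversely an inner
    lattice point of a new face is new, hence of the form [gamma + b], and cones of the fan contain
    the summands in [Cj] of their points. *)
Lemma star_new_point (j : nat) (gamma : 'rV[int]_d) : (j < size Cs)%N ->
  let Cj := nth set0 Cs j in
  new_points Cs j = [set gamma + a | a in lattice_points Cj] ->
  star (fan_of Cj) gamma =
    fan_of Cj `\` \bigcup_(i in `I_j) fan_of (nth set0 Cs i).
Proof.
move=> js Cj newE; have SCj := (facet_ordering_nth js).1.
have [Cjg gN] : new_points Cs j gamma.
  rewrite newE; exists 0; rewrite ?addr0 //= /lattice_points /= latt0.
  exact: rational_cone0 (fan_rational SCj).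
apply/seteqP; split=> D [CjD].
  move=> Dg; split=> // -[i /= ij Ci]; apply: (gN i ij).
  exact: face_sub Ci _ Dg.
move=> nD; split=> //; have SD := fan_face SCj CjD.
have [a Da] := inner_lattice SD.
have : new_points Cs j a.
  split; first by apply: (face_sub CjD); case: Da.
  move=> i ij Cia; have SCi := (facet_ordering_nth (ltn_trans ij js)).1.
  apply: nD; exists i => //; apply: fan_sub_face => //.
  exact: inner_fan_sub Da Cia.
rewrite newE => -[b Cjb ab]; apply: (latt_fan_addl SCj SD Cjg Cjb).
by rewrite ab; case: Da.
Qed.

(* The facets of C_j avoiding gamma are those visible from - gamma. *)
Lemma shelling_step (j : nat) (gamma : 'rV[int]_d) : (0 < j < size Cs)%N ->
  let Cj := nth set0 Cs j in
  Cj (latt R gamma) ->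
  star (fan_of Cj) gamma =
    fan_of Cj `\` \bigcup_(i in `I_j) fan_of (nth set0 Cs i) ->
  exists (Ds : seq (set 'rV[R]_d)) (r : nat),
    let common := \bigcup_(i in `I_j) (fan_of (nth set0 Cs i) `&` fan_of Cj) in
    [/\ shelling (bd_fan_of Cj) Ds, (1 <= r <= size Ds)%N, common !=set0
      & common = \bigcup_(l in `I_r) fan_of (nth set0 Ds l)].
Proof.
move=> /andP[j0 js] Cj Cjg starE; have SCj := (facet_ordering_nth js).1.
have [s CjE] := fan_fg SCj; have fgCj : fg_cone Cj by exists s.
have [|Ds [r [shD rs rP]]] := @bruggesser_mani R d (size s).+1 s (- latt R gamma) (leqnn _).
  by rewrite -CjE -scaleN1r; apply: linZ => //; exact: sub_lin.
rewrite -CjE in shD rP.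
exists Ds, r; set common := bigcup _ _ => /=.
have visP F : facets (bd_fan_of Cj) F ->
    ev (- latt R gamma) (facet_form Cj F) < 0 <-> ~ F (latt R gamma).
  move=> [[CF _] _]; have [u0 FE] := facet_formP CF; rewrite evNl oppr_lt0.
  rewrite {2}FE; split=> [g0 [_ /= g0']|nF].
    by move: g0; rewrite [ev _ _]g0' ltxx.
  rewrite lt_neqAle u0 // andbT eq_sym; apply/eqP => g0; apply: nF; split => //.
have commonP F : common F <-> face F Cj /\ ~ F (latt R gamma).
  have starP : star (fan_of Cj) gamma F <-> face F Cj /\ F (latt R gamma) by [].
  rewrite starE in starP; split=> [[i ij [Fi Fj]]|[Fj nF]].
    split=> // Fg; have [_] : (fan_of Cj `\` \bigcup_(i in `I_j) fan_of (nth set0 Cs i)) F.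
      by apply/starP.
    by apply; exists i.
  apply: contrapT => nc; apply: nF; have [] // : face F Cj /\ F (latt R gamma).
  by apply/starP; split=> // -[i ij Fi]; apply: nc; exists i.
have SC0 := (facet_ordering_nth (ltn_trans j0 js)).1.
have [f0 fj] := fan_inter SC0 SCj.
have common0 : common !=set0 by exists (nth set0 Cs 0 `&` Cj); exists 0%N.
have commonE : common = \bigcup_(l in `I_r) fan_of (nth set0 Ds l).
  apply/seteqP; split=> F.
    move=> /commonP[CjF nF].
    (* If every facet of [Cj] through [F] contained [gamma], then [- gamma] could be pushed along an
       inner point of [F] into [Cj]; the form of [F] would then vanish at [gamma], against [nF]. *)
    apply/(bigcup_take_fan _ rs); apply: contrapT => noG.
    have fgF := fg_face fgCj CjF; have [f fin] := inner_exists fgF.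
    have [|G fG FG|t Ct] := push_into_cone fgCj (face_sub CjF) fin (x := - latt R gamma).
    - by rewrite -scaleN1r; apply: linZ => //; exact: sub_lin.
    - rewrite leNgt; apply/negP => gG; apply: noG; exists G; first exact/rP.
      exact: face_sub_face CjF FG (face_sub fG.1.1).
    have [u0 FE] := facet_formP CjF; have := u0 _ Ct.
    have Ff : F f by case: fin.
    have f0' : ev f (facet_form Cj F) = 0 by move: Ff; rewrite {1}FE => -[].
    rewrite evDl evZl f0' mulr0 add0r evNl oppr_ge0 => g0; apply: nF.
    by rewrite FE; split=> //=; apply/eqP; rewrite eq_le g0 u0.
  move=> /(bigcup_take_fan _ rs)[G /rP[fG gG] GF]; apply/commonP; split.
    exact: face_trans fgCj fG.1.1 GF.
  by move=> /(face_sub GF); apply/visP.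
split=> //; rewrite rs andbT lt0n; apply/eqP => r0.
by have [F] := common0; rewrite commonE r0 => -[].
Qed.

End Ordering.

Lemma shelling_ordering Cs : shelling (fan_cones Sigma) Cs ->
  facet_ordering (fan_cones Sigma) Cs.
Proof. by case. Qed.

(** From right to left, line shellings provide the boundary shellings, and the star and union
    conditions are read off from the new points. *)
Lemma shelling_monoid Cs :
  (shelling (fan_cones Sigma) Cs /\
     forall j : nat, (0 < j < size Cs)%N ->
       let Cj := nth set0 Cs j in
       exists gamma : 'rV[int]_d,
         [/\ lattice_points Cj gamma,
             star (fan_of Cj) gamma =
               fan_of Cj `\` \bigcup_(i in `I_j) fan_of (nth set0 Cs i)
           & \bigcup_(D in star (fan_of Cj) gamma) lattice_points (relint D) =
               [set gamma + a | a in lattice_points Cj]]) <->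
  monoid_shelling Cs.
Proof.
split=> [[/shelling_ordering Cs_ord CsP]|[Cs_ord CsP]].
  split=> // -[|j] js.
    exists 0.
      rewrite /lattice_points /= latt0; apply: rational_cone0.
      exact: fan_rational (facet_ordering_nth Cs_ord js).1.
    apply/seteqP; split=> [a [C0a _]|_ [a C0a <-]].
      by exists a; rewrite ?add0r.
    by rewrite add0r.
  have [gamma [Cg starE unionE]] := CsP j.+1 js; exists gamma => //.
  by rewrite -unionE; exact: new_pointsE.
have s0 : (0 < size Cs)%N.
  rewrite lt0n; apply/negP; rewrite size_eq0 => /eqP Cs0.
  have [C SC] := fan_nonempty Sigma.
  have [_ facetsE] := Cs_ord; rewrite Cs0 in facetsE.
  have [D fD _] := sub_facet SC.
  by have : [set C | C \in [::]] D by rewrite facetsE.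
split.
  apply: shelling_rec => //.
    have SC0 := (facet_ordering_nth Cs_ord s0).1; have [s C0E] := fan_fg SC0.
    rewrite C0E; have [|Ds [r [? _ _]]] := @bruggesser_mani R d (size s).+1 s 0 (leqnn _).
      by exists 0, 0; rewrite subr0; split=> //; exact: cone0.
    by exists Ds.
  move=> j js; have /andP[j0 js'] := js; have [gamma Cg newE] := CsP j js'.
  by apply: (@shelling_step _ Cs_ord j gamma) => //; exact: star_new_point.
move=> j /andP[j0 js] /=; have [gamma Cg newE] := CsP j js.
have starE := star_new_point Cs_ord js newE.
by exists gamma; split=> //; rewrite -newE (new_pointsE Cs_ord js starE).
Qed.

End RationalFans.

(** * Prime filtrations of a ring as a module over itself *)

Section CleanRings.
Variable A : comNzRingType.
Implicit Types (L N : submodClosed A^o) (P : prime_idealr A).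

Definition prime_ideal_pack (S : {pred A}) (h : prime_ideal S) : prime_idealr A :=
  HB.pack ((S : A -> bool) : A -> bool) (isIdealr.Build A (S : A -> bool) h.1)
    (isPrimeIdealrClosed.Build A (S : A -> bool) h.2).

Definition submod_pack (S : {pred A^o}) (h : submod_closed S) : submodClosed A^o :=
  HB.pack ((S : A^o -> bool) : A^o -> bool)
    (GRing.isSubmodClosed.Build A A^o (S : A^o -> bool) h).

Lemma quot_pi_eq L (x y : A^o) : quot_pi L x = quot_pi L y <-> x - y \in L.
Proof. by rewrite -quot_piE; split=> [->|/eqP]. Qed.

Lemma submodMl L (a x : A) : (x : A^o) \in L -> (a * x : A^o) \in L.
Proof. exact: (@rpredZ _ _ L a x). Qed.

(** The element [e] lifts the image of 1: its class generates the factor and has annihilator [P]. *)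
Lemma subquot_isoP L N P : {subset L <= N} ->
  subquot_iso L N P <-> exists e : A,
    (forall a : A, ((a * e : A^o) \in L) = (a \in P)) /\
    (forall n : A, (n : A^o) \in N <-> exists a : A, (n - a * e : A^o) \in L).
Proof.
move=> LN; split=> [[f [f_inj f_range]]|[e [eP eN]]].
  have [e fe] := quot_pi_surj (f (quot_pi (prime_submod P) (1 : A^o))).
  have fE (a : A) : f (quot_pi (prime_submod P) (a : A^o)) = quot_pi L (a * e : A^o).
    have -> : quot_pi (prime_submod P) (a : A^o) = a *: quot_pi (prime_submod P) (1 : A^o).
      by rewrite -linearZ /GRing.scale /= mulr1.
    by rewrite linearZ /= fe -linearZ.
  exists e; split=> [a|n].
    apply/idP/idP => [aL|aP].
      have /f_inj : f (quot_pi (prime_submod P) (a : A^o)) = f (quot_pi (prime_submod P) 0).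
        by rewrite fE !linear0 -(linear0 (quot_pi L)); apply/quot_pi_eq; rewrite subr0.
      by move=> /quot_pi_eq; rewrite subr0.
    have <- : a * e - 0 = a * e :> A^o by rewrite subr0.
    apply/quot_pi_eq; rewrite -fE linear0.
    have -> : quot_pi (prime_submod P) (a : A^o) = 0.
      by rewrite -(linear0 (quot_pi (prime_submod P))); apply/quot_pi_eq; rewrite subr0.
    exact: linear0.
  split=> [nN|[a na]].
    have : range f (quot_pi L (n : A^o)) by rewrite f_range; exists n.
    move=> [v _]; have [a ->] := quot_pi_surj v.
    by rewrite fE => /esym/quot_pi_eq; exists a.
  have : range f (quot_pi L (n : A^o)).
    by exists (quot_pi (prime_submod P) (a : A^o)) => //; rewrite fE; apply/esym/quot_pi_eq.
  rewrite f_range => -[m /= mN /quot_pi_eq mn].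
  by have := (submod_zmodP N).2 _ _ mN (LN _ mn); rewrite subKr.
pose f (v : quot_mod (prime_submod P)) : quot_mod L := quot_pi L (repr v * e : A^o).
have fE (a : A) : f (quot_pi (prime_submod P) (a : A^o)) = quot_pi L (a * e : A^o).
  apply/quot_pi_eq; rewrite -mulrBl.
  suff : (repr (quot_pi (prime_submod P) (a : A^o)) - a : A) \in P by rewrite -eP.
  by apply/(@quot_pi_eq (prime_submod P)); rewrite /quot_pi reprK.
have f_lin : linear f.
  move=> a u v; have [x ->] := quot_pi_surj u; have [y ->] := quot_pi_surj v.
  rewrite -linearP !fE -linearP /=; congr quot_pi.
  by rewrite /GRing.scale /= mulrDl mulrA.
pose F : {linear quot_mod (prime_submod P) -> quot_mod L} :=
  HB.pack f (GRing.isLinear.Build A (quot_mod (prime_submod P)) (quot_mod L) *:%R f f_lin).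
exists F; split=> [u v|].
  have [x ->] := quot_pi_surj u; have [y ->] := quot_pi_surj v.
  rewrite [LHS]fE [RHS]fE => /quot_pi_eq; rewrite -mulrBl eP => xy.
  by apply/quot_pi_eq.
apply/seteqP; split=> [_ [u _ <-]|_ [n /= /eN[a na] <-]].
  have [a ->] := quot_pi_surj u; exists (a * e); last exact/esym/fE.
  by apply/eN; exists a; rewrite subrr rpred0.
exists (quot_pi (prime_submod P) (a : A^o)) => //; apply: etrans (fE a) _.
by apply/esym/quot_pi_eq.
Qed.

(** Every prime is in the support of the ring, since the fraction 1/1 is nonzero in each
    localization at a prime. *)
Lemma min_suppP (S : {pred A}) : min_supp A^o S <->
  prime_ideal S /\ forall Q : {pred A}, prime_ideal Q -> {subset Q <= S} -> Q = S.
Proof.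
have suppP (Q : {pred A}) : module_supp A^o Q <-> prime_ideal Q.
  split=> [[]//|Qp]; split=> //; exists 1, 1; split.
    by case: Qp => -[].
  move=> [u uQ] /=; rewrite scaler0 subr0 scale1r => /eqP.
  rewrite /GRing.scale /= mulr1 => /eqP u0; case: Qp => -[Q0 _ _] _.
  by rewrite u0 Q0 in uQ.
split=> [[/suppP Sp Smin]|[Sp Smin]]; split=> //.
- by move=> Q /suppP; exact: Smin.
- exact/suppP.
- by move=> Q /suppP; exact: Smin.
Qed.

End CleanRings.

Lemma addr_le_eq (R : numDomainType) (x y x' y' : R) :
  x <= x' -> y <= y' -> x' + y' = x + y -> x' = x /\ y' = y.
Proof.
move=> xx' yy' /eqP; rewrite -subr_eq0 opprD addrACA paddr_eq0 ?subr_ge0 //.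
by rewrite !subr_eq0 => /andP[/eqP -> /eqP ->].
Qed.

(** * Monomials, lowest terms and the primes attached to cones *)

Section ToricFaceRing.
Variables (K : fieldType) (R : realType) (d : nat) (Sigma : fan R d).
Local Notation A := (toric_face_ring K Sigma).
Local Notation xm := (@xmonom K R d Sigma).
Local Notation idx := (monom_idx Sigma).
Implicit Types (f g h : A) (a b c : idx) (C D : set 'rV[R]_d) (u : 'cV[R]_d).

Definition in_cone C a := C (latt R (val a)).

Lemma monom_mul_val a b c : monom_mul a b = Some c -> val c = val a + val b.
Proof.
have [/monom_mulE[e -> eE] [<-] //|/monom_mulN -> //] := pselect (common_cone a b).
Qed.

Lemma monom_mul_cone C a b c : fan_cones Sigma C -> monom_mul a b = Some c ->
  in_cone C c -> in_cone C a /\ in_cone C b.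
Proof.
move=> SC abc; rewrite /in_cone (monom_mul_val abc).
have [[D [SD Da Db]]|/monom_mulN] := pselect (common_cone a b); last by rewrite abc.
move=> Cab; split; first exact: latt_fan_addl SD SC Da Db Cab.
by rewrite addrC in Cab; exact: latt_fan_addl SD SC Db Da Cab.
Qed.

Lemma in_cone_monom_mul C a b : fan_cones Sigma C -> in_cone C a -> in_cone C b ->
  exists2 c, monom_mul a b = Some c & in_cone C c.
Proof.
move=> SC Ca Cb; have [|c abc cE] := @monom_mulE _ _ _ a b; first by exists C.
exists c => //; rewrite /in_cone [val c]cE lattD.
exact: rational_coneD (fan_rational SC) Ca Cb.
Qed.

Lemma mcoeff_xmonom a b : mcoeff b (xm a) = (a == b)%:R.
Proof. by rewrite xmonom.unlock mcoeffU. Qed.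

Lemma mcoeff_sum (I : Type) (r : seq I) (F : I -> A) c :
  mcoeff c (\sum_(i <- r) F i) = \sum_(i <- r) mcoeff c (F i).
Proof.
elim: r => [|i r IH]; first by rewrite !big_nil mcoeff0.
by rewrite !big_cons mcoeffD IH.
Qed.

Lemma mcoeffM f g c : mcoeff c (f * g) =
  \sum_(a <- msupp f) \sum_(b <- msupp g)
     mcoeff a f * mcoeff b g * (monom_mul a b == Some c)%:R.
Proof.
rewrite -[f * g]/(tfr_mul f g) tfr_mul.unlock mcoeff_sum.
apply: eq_bigr => a _; rewrite mcoeff_sum; apply: eq_bigr => b _ /=.
rewrite mcoeffZ /xmonom_mul; case: (monom_mul a b) => [e|] /=.
  by rewrite mcoeff_xmonom.
by rewrite mcoeff0.
Qed.

Lemma mcoeffM_neq0 f g c : mcoeff c (f * g) != 0 ->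
  exists a b, [/\ mcoeff a f != 0, mcoeff b g != 0 & monom_mul a b = Some c].
Proof.
apply: contraNP => h; rewrite mcoeffM big1_seq // => a /andP[_ af].
rewrite big1_seq // => b /andP[_ bg]; case: eqP => [abc|_]; last by rewrite mulr0.
by case: h; exists a, b; rewrite !mcoeff_neq0.
Qed.

Lemma mcoeffM_unique f g a b c : monom_mul a b = Some c ->
  mcoeff a f != 0 -> mcoeff b g != 0 ->
  (forall a' b', mcoeff a' f != 0 -> mcoeff b' g != 0 ->
     monom_mul a' b' = Some c -> a' = a /\ b' = b) ->
  mcoeff c (f * g) = mcoeff a f * mcoeff b g.
Proof.
move=> abc fa gb abP; rewrite mcoeffM.
pose t a' b' := mcoeff a' f * mcoeff b' g * (monom_mul a' b' == Some c)%:R.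
have t0 a' b' : a' \in msupp f -> b' \in msupp g -> (a' != a) || (b' != b) ->
    t a' b' = 0.
  rewrite -!mcoeff_neq0 => fa' gb' neq; rewrite /t; case: eqP => [abc'|_].
    by move: neq; have [-> ->] := abP _ _ fa' gb' abc'; rewrite !eqxx.
  by rewrite mulr0.
have fa' : a \in msupp f by rewrite -mcoeff_neq0.
have gb' : b \in msupp g by rewrite -mcoeff_neq0.
transitivity (\sum_(b' <- msupp g) t a b').
  rewrite (bigD1_seq a) ?fset_uniq //= -[RHS]addr0; congr (_ + _).
  rewrite big_seq_cond big1 // => e /andP[ef ea].
  by rewrite big_seq big1 // => b' b'g; apply: t0; rewrite ?ea.
rewrite (bigD1_seq b) ?fset_uniq //= {1}/t abc eqxx mulr1 -[RHS]addr0.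
congr (_ + _); rewrite big_seq_cond big1 // => e /andP[eg eb].
by apply: t0; rewrite ?eb ?orbT.
Qed.

(** The form must not vanish at the differences of distinct points of [s]. Transposition exchanges
    vectors and forms, and [generic_in_cone] is applied to the orthant spanned by the unit
    vectors. *)
Lemma generic_form (s : seq 'rV[int]_d) : exists u,
  {in s &, injective (fun v => ev (latt R v) u)}.
Proof.
pose L := [seq (latt R (p.1 - p.2))^T | p <- [seq (v, w) | v <- s, w <- s] & p.1 != p.2].
pose B := [seq delta_mx 0 i : 'rV[R]_d | i <- enum 'I_d].
have [|w _ wP] := @generic_in_cone R d B L.
  move=> u /mapP[[v w]]; rewrite mem_filter /= => /andP[vw _] ->.
  have : latt R (v - w) != 0.
    apply: contraNneq vw => /rowP h; rewrite -subr_eq0; apply/eqP/rowP => i.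
    by have /eqP := h i; rewrite !mxE intr_eq0 => /eqP.
  move=> /rV0Pn[i vi]; exists (delta_mx 0 i).
    by apply: cone_gen; apply: map_f; rewrite mem_enum.
  by rewrite /ev -rowE mxE mxE.
exists w^T => v v' vs v's /= e; apply: contrapT => /eqP neq.
have := wP (latt R (v - v'))^T; rewrite (_ : ev _ _ = 0) ?eqxx.
  have /[swap]/[apply] : (latt R (v - v'))^T \in L; last by [].
  apply/mapP; exists (v, v') => //; rewrite mem_filter neq /=.
  by apply/allpairsP; exists (v, v').
have -> : ev w (latt R (v - v'))^T = ev (latt R (v - v')) w^T.
  by rewrite /ev -[in LHS](trmxK w) -trmx_mul mxE.
have -> : latt R (v - v') = latt R v - latt R v' by exact: raddfB.
by rewrite evBl e subrr.
Qed.

(** The ideal [P_C]: for a cone of the fan, the kernel of the projection onto [K[C]]. *)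
Definition vanish C : {pred A} :=
  fun f => `[< forall a, in_cone C a -> mcoeff a f = 0 >].

Lemma vanishP C f : f \in vanish C <-> forall a, in_cone C a -> mcoeff a f = 0.
Proof. by split=> /asboolP. Qed.

Lemma vanishPn C f : f \notin vanish C -> exists2 a, in_cone C a & mcoeff a f != 0.
Proof.
move=> fC; apply: contrapT => h; case/negP: fC; apply/vanishP => a Ca.
by apply/eqP; apply: contrapT => /negP fa; apply: h; exists a.
Qed.

Lemma vanish0 C : (0 : A) \in vanish C.
Proof. by apply/vanishP => a _; rewrite mcoeff0. Qed.

Lemma vanishD C f g : f \in vanish C -> g \in vanish C -> f + g \in vanish C.
Proof.
by move=> /vanishP fC /vanishP gC; apply/vanishP => a Ca; rewrite mcoeffD fC ?gC ?addr0.
Qed.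

Lemma vanishMl C f g : fan_cones Sigma C -> g \in vanish C -> f * g \in vanish C.
Proof.
move=> SC /vanishP gC; apply/vanishP => c Cc; apply/eqP; apply: contrapT => /negP.
move=> /mcoeffM_neq0[a [b [_ gb abc]]].
by have [_ /gC gb0] := monom_mul_cone SC abc Cc; rewrite gb0 eqxx in gb.
Qed.

Lemma vanishMr C f g : fan_cones Sigma C -> f \in vanish C -> f * g \in vanish C.
Proof. by rewrite mulrC; exact: vanishMl. Qed.

Lemma vanishB C f g : f \in vanish C -> g \in vanish C -> f - g \in vanish C.
Proof.
by move=> /vanishP fC /vanishP gC; apply/vanishP => a Ca; rewrite mcoeffB fC ?gC ?subr0.
Qed.

Lemma lowest_term C f u : f \notin vanish C -> exists a,
  [/\ mcoeff a f != 0, in_cone C a &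
    forall a', mcoeff a' f != 0 -> in_cone C a' ->
      ev (latt R (val a)) u <= ev (latt R (val a')) u].
Proof.
move=> /vanishPn[a0 Ca0 fa0].
pose s := [seq a <- enum_fset (msupp f) | `[< in_cone C a >]].
have sP a : (a \in s) = (mcoeff a f != 0) && `[< in_cone C a >].
  by rewrite mem_filter andbC mcoeff_neq0.
have s0 : s != [::].
  by apply/eqP => s0; have := sP a0; rewrite s0 fa0 asboolT.
have [a] := min_seq (fun a : idx => ev (latt R (val a)) u) s0.
rewrite sP => /andP[fa /asboolP Ca] aP; exists a; split=> // a' fa' Ca'.
by apply: aP; rewrite sP fa' asboolT.
Qed.

(* If u separates the exponents of f and g, then the product of their
   u-lowest terms over C cannot be cancelled. *)
Lemma lowest_term_mul C f g u : fan_cones Sigma C ->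
  {in [seq val a | a <- enum_fset (msupp f) ++ enum_fset (msupp g)] &,
     injective (fun v => ev (latt R v) u)} ->
  f \notin vanish C -> g \notin vanish C ->
  exists a b c, [/\ [/\ mcoeff a f != 0, in_cone C a &
      forall a', mcoeff a' f != 0 -> in_cone C a' ->
        ev (latt R (val a)) u <= ev (latt R (val a')) u],
     [/\ mcoeff b g != 0, in_cone C b &
      forall b', mcoeff b' g != 0 -> in_cone C b' ->
        ev (latt R (val b)) u <= ev (latt R (val b')) u],
     monom_mul a b = Some c, in_cone C c & mcoeff c (f * g) != 0].
Proof.
move=> SC u_inj fC gC; have [a [fa Ca aP]] := lowest_term u fC.
have [b [gb Cb bP]] := lowest_term u gC.
have [c abc Cc] := in_cone_monom_mul SC Ca Cb.
exists a, b, c; split=> //; rewrite (mcoeffM_unique abc fa gb) ?mulf_neq0 //.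
move=> a' b' fa' gb' abc'; have [Ca' Cb'] := monom_mul_cone SC abc' Cc.
have ha := aP a' fa' Ca'; have hb := bP b' gb' Cb'.
have : ev (latt R (val a')) u + ev (latt R (val b')) u =
       ev (latt R (val a)) u + ev (latt R (val b)) u.
  by rewrite -!evDl -!lattD -(monom_mul_val abc) -(monom_mul_val abc').
have inF e : mcoeff e f != 0 -> val e \in
    [seq val a | a <- enum_fset (msupp f) ++ enum_fset (msupp g)].
  by rewrite mcoeff_neq0 => ef; apply: map_f; rewrite mem_cat ef.
have inG e : mcoeff e g != 0 -> val e \in
    [seq val a | a <- enum_fset (msupp f) ++ enum_fset (msupp g)].
  by rewrite mcoeff_neq0 => eg; apply: map_f; rewrite mem_cat eg orbT.
move=> /(addr_le_eq ha hb)[e1 e2].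
by split; apply/val_inj/u_inj => //; first [exact: inF|exact: inG].
Qed.

(** If [f] and [g] both have a monomial in [C], their lowest terms for a generic form multiply to a
    term in [C] that does not cancel. *)
Lemma vanish_prime C : fan_cones Sigma C -> prime_ideal (vanish C).
Proof.
move=> SC; split.
  split=> [||f g h]; first exact: vanish0.
    have C0 : in_cone C (monom_idx0 Sigma).
      by rewrite /in_cone /= latt0; exact: rational_cone0 (fan_rational SC).
    apply/negP => /vanishP/(_ _ C0)/eqP.
    by rewrite [mcoeff _ _]mcoeff_xmonom eqxx oner_eq0.
  by move=> gC hC; apply: vanishD => //; exact: vanishMl.
move=> f g; apply: contraLR; rewrite negb_or => /andP[fC gC].
have [u u_inj] := generic_form [seq val a | a <- enum_fset (msupp f) ++ enum_fset (msupp g)].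
have [a [b [c [_ _ _ Cc fgc]]]] := lowest_term_mul SC u_inj fC gC.
by apply/negP => /vanishP/(_ _ Cc) fgc0; rewrite fgc0 eqxx in fgc.
Qed.

Lemma vanishM C f g : fan_cones Sigma C ->
  (f * g \in vanish C) = (f \in vanish C) || (g \in vanish C).
Proof. by move=> SC; rewrite -(prime_idealrM (prime_ideal_pack (vanish_prime SC))). Qed.

(** The lowest and the highest term of the product over [C] both have exponent [a0], so the lowest
    and highest terms of [g] over [C] coincide. *)
Lemma monomial_factor C f g a0 : fan_cones Sigma C -> in_cone C a0 ->
  xm a0 - f * g \in vanish C ->
  exists b, [/\ in_cone C b, mcoeff b g != 0 &
    forall b', in_cone C b' -> mcoeff b' g != 0 -> b' = b].
Proof.
move=> SC Ca0 /vanishP fgE.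
have {}fgE c : in_cone C c -> mcoeff c (f * g) = (a0 == c)%:R.
  by move=> Cc; have := fgE c Cc; rewrite mcoeffB mcoeff_xmonom => /subr0_eq.
have fgC : f * g \notin vanish C.
  by apply/negP => /vanishP/(_ _ Ca0)/eqP; rewrite fgE // eqxx oner_eq0.
have [fC gC] : f \notin vanish C /\ g \notin vanish C.
  by move: fgC; rewrite vanishM // negb_or => /andP.
set s := [seq val a | a <- enum_fset (msupp f) ++ enum_fset (msupp g)].
have [u u_inj] := generic_form s.
(* Lowest terms for [- u] are highest terms for [u]. *)
have u_injN : {in s &, injective (fun v => ev (latt R v) (- u))}.
  by move=> v w vs ws /=; rewrite !evNr => /oppr_inj; exact: u_inj.
have [a [b [c [[fa Ca aP] [gb Cb bP] abc Cc fgc]]]] := lowest_term_mul SC u_inj fC gC.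
have [a' [b' [c' [[fa' Ca' aP'] [gb' Cb' bP'] abc' Cc' fgc']]]] :=
  lowest_term_mul SC u_injN fC gC.
have a0P e : in_cone C e -> mcoeff e (f * g) != 0 -> a0 = e.
  by move=> Ce; rewrite fgE //; case: (a0 =P e) => // _; rewrite eqxx.
have ec : c = c' by rewrite -(a0P c) // -(a0P c').
have : ev (latt R (val a')) u + ev (latt R (val b')) u =
       ev (latt R (val a)) u + ev (latt R (val b)) u.
  by rewrite -!evDl -!lattD -(monom_mul_val abc) -(monom_mul_val abc') ec.
move=> esum; exists b; split=> // e Ce ge.
have [_ eb] := addr_le_eq (aP _ fa' Ca') (bP _ gb' Cb') esum.
have := bP' _ ge Ce; rewrite !evNr lerN2 eb => h.
apply/val_inj/u_inj => /=; last by apply/eqP; rewrite eq_le h bP.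
  by apply: map_f; rewrite mem_cat -!mcoeff_neq0 ge orbT.
by apply: map_f; rewrite mem_cat -!mcoeff_neq0 gb orbT.
Qed.

End ToricFaceRing.

(** * Minimal primes of the toric face ring *)

Section CleanToricFaceRing.
Variables (K : fieldType) (R : realType) (d : nat) (Sigma : fan R d).
Local Notation A := (toric_face_ring K Sigma).
Local Notation xm := (@xmonom K R d Sigma).
Local Notation idx := (monom_idx Sigma).
Local Notation facet := (facets (fan_cones Sigma)).
Local Notation vanish C := (@vanish K R d Sigma C).
Implicit Types (f g h : A) (a b c : idx) (C D : set 'rV[R]_d).

Lemma vanish_eq0 f : (forall C, facet C -> f \in vanish C) -> f = 0.
Proof.
move=> fC; apply/malgP => a; rewrite mcoeff0.
have /set_mem[C SC Ca] := valP a; have [D fD CD] := sub_facet SC.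
by have /vanishP := fC D fD; apply; exact: CD.
Qed.

Lemma lattice_idx C (v : 'rV[int]_d) : fan_cones Sigma C -> C (latt R v) ->
  exists2 a : idx, val a = v & in_cone C a.
Proof.
by move=> SC Cv; exists (Sub v (monom_idxP SC Cv)); rewrite /in_cone ?SubK.
Qed.

Lemma xmonom_vanish C a : (xm a \in vanish C) <-> ~ in_cone C a.
Proof.
split=> [/vanishP h Ca|nCa].
  by have /eqP := h a Ca; rewrite mcoeff_xmonom eqxx oner_eq0.
apply/vanishP => b Cb; rewrite mcoeff_xmonom; case: (a =P b) => // ab.
by case: nCa; rewrite ab.
Qed.

Lemma inner_monomial C : fan_cones Sigma C -> exists a : idx,
  in_cone C a /\ forall D, fan_cones Sigma D -> in_cone D a -> C `<=` D.
Proof.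
move=> SC; have [v vC] := inner_lattice SC.
have [|a av Ca] := @lattice_idx C v SC; first by case: vC.
exists a; split=> // D SD Da; apply: (inner_fan_sub SC SD vC).
by rewrite -av.
Qed.

(** The monomial [xm a] lies in every minimal prime except that of [C], so multiplying by it
    isolates one component. *)
Lemma facet_separation C : facet C -> exists a : idx,
  in_cone C a /\ forall D, facet D -> D <> C -> ~ in_cone D a.
Proof.
move=> [SC Cmax]; have [a [Ca aP]] := inner_monomial SC.
exists a; split=> // D [SD Dmax] DC /(aP D SD) CD.
exact/DC/Cmax.
Qed.

Lemma vanish_sub C D : fan_cones Sigma C -> fan_cones Sigma D ->
  {subset vanish C <= vanish D} -> D `<=` C.
Proof.
move=> SC SD CD; have [a [Da aP]] := inner_monomial SD.
apply: aP => //; apply: contrapT => /xmonom_vanish/CD/xmonom_vanish.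
exact.
Qed.

(** Otherwise pick in each [vanish C] an element outside [Q]. The product lies in all these ideals,
    so it is zero, yet it is outside the prime [Q]. *)
Lemma prime_contains_vanish (Q : {pred A}) : prime_ideal Q ->
  exists2 C, facet C & {subset vanish C <= Q}.
Proof.
move=> Qp; apply: contrapT => noC.
have : finite_set facet.
  by apply: sub_finite_set (fan_finite Sigma) => C [].
move=> /finite_seqP[Fs FsE].
have fFs C : C \in Fs -> facet C by rewrite FsE.
have [f fQ fP] : exists2 f, f \notin Q & forall C, C \in Fs -> f \in vanish C.
  elim: Fs {FsE} fFs => [|C r IH] fFs.
    by exists 1 => //; case: Qp => -[].
  have [D Dr|f fQ fP] := IH; first by apply: fFs; rewrite inE Dr orbT.
  have fC : facet C by apply: fFs; rewrite inE eqxx.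
  have [g gC gQ] : exists2 g, g \in vanish C & g \notin Q.
    apply: contrapT => nog; apply: noC; exists C => // g gC.
    by apply: contrapT => /negP gQ; apply: nog; exists g.
  exists (g * f).
    by apply/negP => /(Qp.2)/orP[]; apply/negP.
  move=> D; rewrite inE => /orP[/eqP ->|Dr]; first exact: vanishMr fC.1 gC.
  have fD : facet D by apply: fFs; rewrite inE Dr orbT.
  by apply: vanishMl; [exact: fD.1|exact: fP].
have f0 : f = 0.
  by apply: vanish_eq0 => C fC; apply: fP; have : [set` Fs] C by rewrite -FsE.
by move: fQ; rewrite f0; case: Qp => -[-> _ _].
Qed.

Lemma min_supp_vanish (S : {pred A}) :
  min_supp A^o S <-> exists2 C, facet C & S = vanish C.
Proof.
split=> [/min_suppP[Sp Smin]|[C fC ->]].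
  have [C fC CS] := prime_contains_vanish Sp; exists C => //.
  by apply/esym/Smin => //; exact: vanish_prime fC.1.
apply/min_suppP; split; first exact: vanish_prime fC.1.
move=> Q Qp QC; have [D fD DQ] := prime_contains_vanish Qp.
have CD : C `<=` D by apply: vanish_sub fD.1 fC.1 _ => f /DQ/QC.
have DC := fC.2 D fD.1 CD; apply/funext => f; apply/idP/idP; first exact: QC.
by move=> fC'; apply: DQ; rewrite DC.
Qed.

(** * From a clean filtration to a monoid shelling *)

Section FromFiltration.
(** [e k] lifts a generator of the factor of [F k.+1] by [F k], whose annihilator is the prime of
    the facet [c k]. *)
Variables (r : nat) (F : nat -> submodClosed A^o) (e : nat -> A).
Variable c : nat -> set 'rV[R]_d.
Hypotheses (F0 : F 0%N =i pred1 0) (Fr : F r =i predT).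
Hypothesis c_facet : forall k, (k < r)%N -> facet (c k).
Hypothesis c_onto : forall C, facet C -> exists2 k, (k < r)%N & c k = C.
Hypothesis F_mono : forall k, (k < r)%N -> {subset F k <= F k.+1}.
Hypothesis eF : forall k, (k < r)%N -> forall f,
  ((f * e k : A^o) \in F k) = (f \in vanish (c k)).
Hypothesis F_succ : forall k, (k < r)%N -> forall f,
  (f : A^o) \in F k.+1 <-> exists g, (f - g * e k : A^o) \in F k.

Lemma filtration_le k l f : (k <= l <= r)%N -> (f : A^o) \in F k -> (f : A^o) \in F l.
Proof.
move=> /andP[/subnK <-]; elim: (l - k)%N => // n IH nr fF.
by rewrite addSn; apply: F_mono => //; apply: IH => //; exact: ltnW.
Qed.

Lemma filtration_sub k l f : (k <= l < r)%N -> (f : A^o) \in F k -> f \in vanish (c l).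
Proof.
move=> /andP[kl lr] fF; rewrite -eF // mulrC; apply: submodMl.
by apply: (@filtration_le k) => //; rewrite kl ltnW.
Qed.

Lemma generator_in k : (k < r)%N -> (e k : A^o) \in F k.+1.
Proof. by move=> kr; apply/F_succ => //; exists 1; rewrite mul1r subrr rpred0. Qed.

(** If a facet occurred twice, [e k] would lie in its prime and [xm a], with [a] in this facet only,
    in all the others. Then [xm a * e k] is zero, so [xm a] annihilates the factor, a
    contradiction. *)
Lemma filtration_facet_inj k l : (k < l < r)%N -> c k <> c l.
Proof.
move=> /andP[kl lr] ckl; have kr := ltn_trans kl lr.
have [a [Ca aP]] := facet_separation (c_facet kr).
suff : xm a \in vanish (c k) by move=> /xmonom_vanish.
rewrite -eF // (_ : _ * _ = 0) ?rpred0 //.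
apply: vanish_eq0 => D fD; have [->|DC] := pselect (D = c k).
  apply: vanishMl; first exact: (c_facet kr).1.
  rewrite ckl; apply: (@filtration_sub k.+1); last exact: generator_in.
  by rewrite kl lr.
apply: vanishMr; first exact: fD.1.
by apply/xmonom_vanish; exact: aP.
Qed.

(** Descend from [F r]: if [f = g * e m + z] with [z] in [F m], multiply by a monomial [xm a] that
    kills [f] but is outside the prime of [c m]. Then [g] lies in this prime, so [g * e m] and [f]
    are in [F m]. *)
Lemma filtration_vanish k f : (k <= r)%N ->
  (forall l, (k <= l < r)%N -> f \in vanish (c l)) -> (f : A^o) \in F k.
Proof.
move=> kr fv; suff h n : (n <= r - k)%N -> (f : A^o) \in F (r - n).
  by have := h (r - k)%N (leqnn _); rewrite subKn.
elim: n => [|n IH] nk; first by rewrite subn0 Fr.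
set m := (r - n.+1)%N; have mr : (m < r)%N by rewrite /m; lia.
have km : (k <= m)%N by rewrite /m; lia.
have {}IH : (f : A^o) \in F m.+1.
  by rewrite (_ : m.+1 = r - n)%N ?IH ?(ltnW nk) // /m; lia.
have [g gF] := (F_succ mr f).1 IH; set z := f - g * e m in gF.
have [a [Ca aP]] := facet_separation (c_facet mr).
have af0 : xm a * f = 0.
  apply: vanish_eq0 => D fD; have [->|DC] := pselect (D = c m).
    by apply: vanishMl; [exact: (c_facet mr).1|apply: fv; rewrite km].
  apply: vanishMr; first exact: fD.1.
  by apply/xmonom_vanish; exact: aP.
have : ((- xm a) * z : A^o) \in F m by exact: submodMl.
rewrite /z mulrBr mulNr af0 oppr0 sub0r mulNr opprK mulrA eF //.
rewrite vanishM; last exact: (c_facet mr).1.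
case/orP => [/xmonom_vanish //|]; rewrite -eF // => geF.
by rewrite -[f](subrK (g * e m)); exact: (@rpredD _ (submod_zmod (F m))).
Qed.

Lemma filtration_monoid_shelling : exists Cs, monoid_shelling Sigma Cs.
Proof.
(* The order is reversed because [F k] is the intersection of the primes with index at least [k]:
   the new points of [c k] are those outside every [c l] with [l > k]. *)
pose Cs := mkseq (fun j => c (r - j.+1)) r; exists Cs.
have CsE j : (j < r)%N -> nth set0 Cs j = c (r - j.+1)%N by move=> jr; rewrite nth_mkseq.
split.
  split.
    apply/mkseq_uniqP => i j; rewrite !inE => ir jr cij.
    have [] := ltngtP i j => // ij; exfalso.
      apply: (@filtration_facet_inj (r - j.+1) (r - i.+1)) (esym cij).
      by apply/andP; split; lia.
    apply: (@filtration_facet_inj (r - i.+1) (r - j.+1)) cij.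
    by apply/andP; split; lia.
  apply/seteqP; split=> C /=.
    by move=> /mapP[j]; rewrite mem_iota => /= jr ->; apply: c_facet; lia.
  move=> /c_onto[k kr <-]; apply/mapP; exists (r - k.+1)%N.
    by rewrite mem_iota /=; lia.
  by congr c; lia.
rewrite size_mkseq => j jr; rewrite CsE //; set k := (r - j.+1)%N.
have kr : (k < r)%N by rewrite /k; lia.
have [SC Cmax] := c_facet kr.
have newP v : new_points Cs j v <->
    c k (latt R v) /\ forall l, (k < l < r)%N -> ~ c l (latt R v).
  rewrite /new_points /lattice_points /= CsE //; split=> -[Cv vN]; split=> //.
    move=> l /andP[kl lr]; have := vN (r - l.+1)%N; rewrite CsE; last by lia.
    by rewrite (_ : (r - (r - l.+1).+1)%N = l); [apply; rewrite /k in kl; lia|lia].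
  move=> i ij; rewrite CsE; last by lia.
  by apply: vN; rewrite /k; lia.
have newM a : new_points Cs j (val a) -> exists g, xm a - g * e k \in vanish (c k).
  move=> /newP[Ca aN].
  have : (xm a : A^o) \in F k.+1.
    by apply: filtration_vanish => // l kl; apply/xmonom_vanish; exact: aN.
  by move=> /(F_succ kr)[g gF]; exists g; apply: filtration_sub gF; rewrite leqnn.
have eN l : (k < l < r)%N -> e k \in vanish (c l).
  by move=> kl; apply: filtration_sub kl (generator_in kr).
(* As [a0] is in no other facet, it is new, and [xm a0] is a multiple of [e k] modulo
   [vanish (c k)]. Hence [e k] has exactly one monomial in [c k]; its exponent is [gamma]. *)
have [a0 [Ca0 a0P]] := facet_separation (c_facet kr).
have [|g0 g0P] := newM a0.
  apply/newP; split=> // l klr; apply: a0P; first by apply: c_facet; case/andP: klr.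
  by apply/nesym; exact: filtration_facet_inj.
have [b [Cb eb bP]] := monomial_factor SC Ca0 g0P.
exists (val b); first exact: Cb.
apply/seteqP; split=> v.
  move=> vnew; have /newP[Cv _] := vnew.
  have [a av Ca] := lattice_idx SC Cv; rewrite -av in vnew *.
  have [g /vanishP/(_ a Ca)] := newM a vnew.
  rewrite mcoeffB mcoeff_xmonom eqxx => /subr0_eq/esym ge1.
  have : mcoeff a (g * e k) != 0 by rewrite ge1 oner_eq0.
  move=> /mcoeffM_neq0[a1 [a2 [_ ea2 a12]]].
  have [Ca1 Ca2] := monom_mul_cone SC a12 Ca.
  exists (val a1) => //.
  by rewrite -(bP a2 Ca2 ea2) addrC -(monom_mul_val a12).
(* [b] occurs in [e k], which vanishes on each [c l] with [l > k]; so neither [b] nor its sum with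
   [w] lies there. *)
move=> [w Cw <-]; apply/newP; split.
  by rewrite lattD; exact: rational_coneD (fan_rational SC) Cb Cw.
move=> l klr Clv; have lr : (l < r)%N by case/andP: klr.
have := latt_fan_addl SC (c_facet lr).1 Cb Cw Clv => Clb.
by have /vanishP/(_ b Clb) eb0 := eN l klr; rewrite eb0 eqxx in eb.
Qed.

End FromFiltration.

Lemma clean_monoid_shelling : clean_ring A -> exists Cs, monoid_shelling Sigma Cs.
Proof.
move=> [r [F [P [[F0 Fr FP] Prange]]]].
have Pfacet (i : 'I_r) : exists C, facet C /\ (P i : {pred A}) = vanish C.
  have : min_supp A^o (P i : {pred A}) by rewrite -Prange; exists i.
  by move=> /min_supp_vanish[C fC PC]; exists C.
(* The bound on [k] is put after the existential so that [choice] gives a function on all of [nat],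
   with dummy values from [r] on. *)
have data k : exists p : set 'rV[R]_d * A, forall kr : (k < r)%N,
    [/\ facet p.1, (P (Ordinal kr) : {pred A}) = vanish p.1,
     forall f, ((f * p.2 : A^o) \in F k) = (f \in vanish p.1) &
     forall f, (f : A^o) \in F k.+1 <-> exists g, (f - g * p.2 : A^o) \in F k].
  have [kr|kr] := pselect (is_true (k < r)%N); last by exists (set0, 0) => kr'; case: (kr kr').
  have [C [fC PC]] := Pfacet (Ordinal kr).
  have [FS /(subquot_isoP _ FS)[e [eP eN]]] := FP (Ordinal kr).
  exists (C, e) => kr'; rewrite (bool_irrelevance kr' kr); split=> //= f.
  by rewrite eP -PC.
have [p pP] := choice data.
apply: (@filtration_monoid_shelling r F (fun k => (p k).2) (fun k => (p k).1)) => //.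
- by move=> k kr; case: (pP k kr).
- move=> C fC; have : min_supp A^o (vanish C) by apply/min_supp_vanish; exists C.
  rewrite -Prange => -[[k kr] _ PC]; exists k => //.
  have [fk Pk _ _] := pP k kr.
  have CE : vanish (p k).1 = vanish C by rewrite -Pk PC.
  apply/seteqP; split.
    by apply: vanish_sub fC.1 fk.1 _ => f; rewrite -CE.
  by apply: vanish_sub fk.1 fC.1 _ => f; rewrite CE.
- by move=> k kr; case: (FP (Ordinal kr)).
- by move=> k kr; case: (pP k kr).
- by move=> k kr; case: (pP k kr).
Qed.

(** * From a monoid shelling to a clean filtration *)

Definition vanish_upto (Cs : seq (set 'rV[R]_d)) (j : nat) : {pred A^o} :=
  fun f => `[< forall i, (i < j)%N -> (f : A) \in vanish (nth set0 Cs i) >].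

Lemma vanish_uptoP Cs j f : (f : A^o) \in vanish_upto Cs j <->
  forall i, (i < j)%N -> f \in vanish (nth set0 Cs i).
Proof. by split=> /asboolP. Qed.

Lemma vanish_upto_submod Cs j : facet_ordering (fan_cones Sigma) Cs ->
  (j <= size Cs)%N -> submod_closed (vanish_upto Cs j).
Proof.
move=> Cs_ord js; split=> [|f g h /vanish_uptoP gC /vanish_uptoP hC];
  apply/vanish_uptoP => i ij.
  exact: vanish0.
apply: vanishD; last exact: hC.
apply: vanishMl; last exact: gC.
exact: (facet_ordering_nth Cs_ord (leq_trans ij js)).1.
Qed.

(** [F k] is the intersection of the primes of the first [r - k] facets, growing from zero to the
    whole ring. Each factor is generated by the monomial with exponent [gamma]. *)
Lemma monoid_shelling_clean Cs : monoid_shelling Sigma Cs -> clean_ring A.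
Proof.
move=> [Cs_ord CsP]; set r := size Cs.
have fCs j : (j < r)%N -> facet (nth set0 Cs j).
  by move=> jr; exact: (facet_ordering_nth Cs_ord jr).
have le_sub k : (r - k <= size Cs)%N by rewrite leq_subr.
pose F k := submod_pack (vanish_upto_submod Cs_ord (le_sub k)).
have FE k f : (f : A^o) \in F k <-> forall i, (i < r - k)%N -> f \in vanish (nth set0 Cs i).
  exact: vanish_uptoP.
have ord_lt (i : 'I_r) : (r - i.+1 < r)%N by have := ltn_ord i; lia.
pose P (i : 'I_r) := prime_ideal_pack (@vanish_prime K R d Sigma _ (fCs _ (ord_lt i)).1).
exists r, F, P; split; last first.
  apply/seteqP; split=> [_ [i _ <-]|S /min_supp_vanish[C fC ->]].
    by apply/min_supp_vanish; exists (nth set0 Cs (r - i.+1)) => //; exact: (fCs _ (ord_lt i)).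
  have : C \in Cs by have : [set C | C \in Cs] C by rewrite Cs_ord.2.
  move=> /(nthP set0)[j jr <-].
  have jr' : (r - j.+1 < r)%N by rewrite ltn_subrL /= (leq_ltn_trans _ jr).
  exists (Ordinal jr') => //=; congr (vanish (nth set0 Cs _)).
  by rewrite subnSK // subKn // ltnW.
split.
- move=> f; apply/idP/eqP => [/FE fC|->]; last exact: rpred0.
  apply: vanish_eq0 => C fC'.
  have : C \in Cs by have : [set C | C \in Cs] C by rewrite Cs_ord.2.
  by move=> /(nthP set0)[j jr <-]; apply: fC; rewrite subn0.
- by move=> f; apply/FE => i; rewrite subnn.
move=> i; set j := (r - i.+1)%N.
have jr : (j < r)%N by exact: (ord_lt i).
have rij : (r - i)%N = j.+1 by rewrite /j; have := ltn_ord i; lia.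
have Fsub : {subset F i <= F i.+1}.
  by move=> f /FE fC; apply/FE => l lj; apply: fC; rewrite rij; exact: ltnW.
split=> //; apply/(subquot_isoP _ Fsub).
have [SC _] := fCs j jr; have [gamma Cg newE] := CsP j jr.
have [a av Ca] := lattice_idx SC Cg.
have anew : new_points Cs j (val a).
  rewrite newE av; exists 0; rewrite ?addr0 //= /lattice_points /= latt0.
  exact: rational_cone0 (fan_rational SC).
have aN l : (l < j)%N -> xm a \in vanish (nth set0 Cs l).
  by move=> lj; apply/xmonom_vanish; case: anew => _; exact.
have aC : xm a \notin vanish (nth set0 Cs j) by apply/negP => /xmonom_vanish.
have fCl l : (l < j)%N -> fan_cones Sigma (nth set0 Cs l).
  by move=> lj; exact: (fCs _ (ltn_trans lj jr)).1.
exists (xm a); split=> [f|f].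
  apply/idP/idP => [/FE/(_ j)|fP].
    by rewrite rij ltnSn vanishM // (negPf aC) orbF; exact.
  apply/FE => l; rewrite rij ltnS leq_eqVlt => /orP[/eqP ->|lj].
    exact: vanishMr.
  by apply: vanishMl; [exact: fCl|exact: aN].
split=> [/FE fC|[g /FE gC]]; last first.
  apply/FE => l lj; rewrite -[f](subrK (g * xm a)); apply: vanishD.
    by apply: gC; rewrite rij; exact: ltnW.
  by apply: vanishMl; [exact: fCl|exact: aN].
(* Treat [f] monomial by monomial: those outside [Cj] are zero modulo its prime; those in [Cj] are
   new because [f] vanishes on the earlier facets, hence divisible by [xm a]. *)
have [g gC] : exists g, f - g * xm a \in vanish (nth set0 Cs j).
  pose Q h := exists g, h - g * xm a \in vanish (nth set0 Cs j).
  have QD h1 h2 : Q h1 -> Q h2 -> Q (h1 + h2).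
    move=> [g1 h1g] [g2 h2g]; exists (g1 + g2).
    by rewrite mulrDl opprD addrACA; exact: vanishD.
  suff : Q (\sum_(b <- msupp f) mcoeff b f *: xm b) by rewrite -xmonomE.
  rewrite big_seq; elim/big_ind: _ => [|//|b fb].
    by exists 0; rewrite mul0r subrr vanish0.
  have [Cb|nCb] := pselect (in_cone (nth set0 Cs j) b); last first.
    exists 0; rewrite mul0r subr0; apply/vanishP => b' Cb'.
    rewrite mcoeffZ mcoeff_xmonom; case: (b =P b') => [bb'|_]; last by rewrite mulr0.
    by case: nCb; rewrite bb'.
  have : new_points Cs j (val b).
    split=> // l lj Clb; have /vanishP/(_ b Clb) fb0 := fC l lj.
    by rewrite -mcoeff_neq0 fb0 eqxx in fb.
  rewrite newE => -[w Cw wb]; have [a' a'w Ca'] := lattice_idx SC Cw.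
  have [b0 b0E Cb0] := in_cone_monom_mul SC Ca' Ca.
  have b0b : b0 = b.
    by apply: val_inj; rewrite (monom_mul_val b0E) av a'w addrC.
  exists (mcoeff b f *: xm a'); rewrite -scalerAl xmonomME b0E /= b0b subrr.
  exact: vanish0.
exists g; apply/FE => l; rewrite rij ltnS leq_eqVlt => /orP[/eqP -> //|lj].
apply: vanishB; first exact: fC.
by apply: vanishMl; [exact: fCl|exact: aN].
Qed.

Lemma clean_iff_monoid_shelling :
  clean_ring A <-> exists Cs, monoid_shelling Sigma Cs.
Proof.
by split=> [|[Cs]]; [exact: clean_monoid_shelling|exact: monoid_shelling_clean].
Qed.

End CleanToricFaceRing.

Theorem theorem5p9 (K : fieldType) (R : realType) (d : nat)
    (Sigma : fan R d) :
  (clean_ring (toric_face_ring K Sigma) <->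
   exists C : seq (set 'rV[R]_d),
     shelling Sigma C /\
     forall j : nat, (0 < j < size C)%N ->
       let Cj := nth set0 C j in
       exists gamma : 'rV[int]_d,
         [/\ lattice_points Cj gamma,
             star (fan_of Cj) gamma =
               fan_of Cj `\` \bigcup_(i in `I_j) fan_of (nth set0 C i)
           & \bigcup_(D in star (fan_of Cj) gamma) lattice_points (relint D) =
               [set gamma + a | a in lattice_points Cj]]) /\
  (forall K' : fieldType,
     clean_ring (toric_face_ring K Sigma) <->
     clean_ring (toric_face_ring K' Sigma)).
Proof.
(* The existence of a monoid shelling does not involve the field. *)
split; last by move=> K'; rewrite !clean_iff_monoid_shelling.
rewrite clean_iff_monoid_shelling.
by split=> -[Cs /shelling_monoid CsP]; exists Cs.
Qed.
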